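(* Let $\{T_t\}_{t\geq0}$ be a strongly continuous semigroup of composition operators in $\mathcal{H}^{\infty}$. Then $T_t=\mathrm{Id}$ for every $t\geq0$.
   Context: $\mathbb{C}_+=\{s\in\mathbb{C}:\operatorname{Re}(s)>0\}$. $\mathcal{H}^\infty$ is the Banach space of bounded analytic functions on $\mathbb{C}_+$ that coincide with a convergent Dirichlet series $\sum_{n\ge1}a_nn^{-s}$ in some half-plane $\{\operatorname{Re}(s)>\theta\}$, with norm $\|f\|_{\mathcal{H}^\infty}=\sup_{s\in\mathbb{C}_+}|f(s)|$. A composition operator in $\mathcal{H}^\infty$ is a bounded operator $\mathcal{H}^\infty\to\mathcal{H}^\infty$ of the form $f\mapsto f\circ\Phi$ with $\Phi:\mathbb{C}_+\to\mathbb{C}_+$ analytic. A family $\{T_t\}_{t\ge0}$ of bounded operators on a Banach space $X$ is a semigroup if $T_0=\mathrm{Id}$ and $T_t\circ T_u=T_{t+u}$ for all $t,u\ge0$; it is strongly continuous if, in addition, $\lim_{t\to0^+}T_tf=f$ in norm for all $f\in X$. A semigroup of composition operators is a semigroup each of whose members $T_t$ is a composition operator. *)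

(* Defs.v *)
From Stdlib Require Import Reals Lra FunctionalExtensionality ProofIrrelevance.
From Coquelicot Require Import Coquelicot.

Open Scope R_scope.

(** * Analytic functions on the right half-plane *)

Definition half_plane : Type := {s : C | 0 < Re s}.

Definition hp_val (s : half_plane) : C := proj1_sig s.
Coercion hp_val : half_plane >-> C.

(* [ex_derive] only applies to functions on all of [C].  As the half-plane is
   open, the value 0 chosen outside it has no influence on differentiability
   at its points. *)
Definition extend (f : half_plane -> C) (z : C) : C :=
  match Rlt_dec 0 (Re z) with
  | left Hz => f (exist _ z Hz)
  | right _ => RtoC 0
  end.

(* Complex differentiability at every point of the open half-plane. *)
Definition analytic (f : half_plane -> C) : Prop :=
  forall s : half_plane,
    ex_derive (K := C_AbsRing) (V := C_NormedModule) (extend f) (s : C).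

Definition bounded_fun (f : half_plane -> C) : Prop :=
  exists M : R, forall s : half_plane, Cmod (f s) <= M.

(** * Dirichlet series *)

Definition Cexp (z : C) : C :=
  (exp (Re z) * cos (Im z), exp (Re z) * sin (Im z)).

(* n^(-s), for n >= 1 *)
Definition dirichlet_term (n : nat) (s : C) : C :=
  Cexp (Copp (Cmult s (RtoC (ln (INR n))))).

(* Dirichlet series start at n = 1, whence the shift; [a 0] is irrelevant. *)
Definition is_dirichlet_series (a : nat -> C) (s l : C) : Prop :=
  is_series (K := C_AbsRing) (V := C_NormedModule)
    (fun n => Cmult (a (S n)) (dirichlet_term (S n) s)) l.

(* [f] is only defined for Re s > 0, so a negative [theta] amounts to 0. *)
Definition has_dirichlet_series (f : half_plane -> C) : Prop :=
  exists (a : nat -> C) (theta : R),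
    forall s : half_plane, theta < Re s -> is_dirichlet_series a s (f s).

(** * The normed complex vector space of bounded Dirichlet series *)

Record Hinf : Type := mkHinf {
  Hinf_fun :> half_plane -> C;
  Hinf_analytic : analytic Hinf_fun;
  Hinf_bounded : bounded_fun Hinf_fun;
  Hinf_dirichlet : has_dirichlet_series Hinf_fun
}.

(* [real] loses nothing: the supremum is finite, see [Hinf_norm_lub]. *)
Definition Hinf_norm (f : Hinf) : R :=
  real (Lub_Rbar (fun r => exists s : half_plane, r = Cmod (f s))).

Lemma Hinf_ext (f g : Hinf) : (forall s, f s = g s) -> f = g.
Proof.
destruct f as [f af bf df], g as [g ag bg dg]; simpl; intros E.
assert (E' : f = g) by (apply functional_extensionality; exact E).
subst g.
now rewrite (proof_irrelevance _ af ag), (proof_irrelevance _ bf bg),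
  (proof_irrelevance _ df dg).
Qed.

Lemma Hinf_norm_lub (f : Hinf) :
  is_lub (fun r => exists s : half_plane, r = Cmod (f s)) (Hinf_norm f).
Proof.
unfold Hinf_norm.
set (E := fun r => exists s : half_plane, r = Cmod (f s)).
assert (HE : E (Cmod (f (exist _ (RtoC 1) Rlt_0_1)))) by (eexists; reflexivity).
destruct (Hinf_bounded f) as [M HM].
destruct (Lub_Rbar_correct E) as [H1 H2].
assert (HMb : Rbar_le (Lub_Rbar E) M).
{ apply H2. intros r [s ->]. exact (HM s). }
pose proof (H1 _ HE) as HL.
destruct (Lub_Rbar E) as [l | |]; simpl in *; try contradiction.
split.
- exact H1.
- intros b Hb. exact (H2 (Finite b) Hb).
Qed.

Lemma Hinf_norm_ub (f : Hinf) (s : half_plane) : Cmod (f s) <= Hinf_norm f.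
Proof. apply (proj1 (Hinf_norm_lub f)). now exists s. Qed.

Lemma Hinf_norm_le (f : Hinf) (M : R) :
  (forall s, Cmod (f s) <= M) -> Hinf_norm f <= M.
Proof. intros H. apply (proj2 (Hinf_norm_lub f)). intros r [s ->]. apply H. Qed.

Lemma Hinf_norm_ge0 (f : Hinf) : 0 <= Hinf_norm f.
Proof.
eapply Rle_trans; [apply Cmod_ge_0|].
exact (Hinf_norm_ub f (exist _ (RtoC 1) Rlt_0_1)).
Qed.

Definition Hinf_zero : Hinf.
Proof.
refine (mkHinf (fun _ => RtoC 0) _ _ _).
- intros s. apply (ex_derive_ext (V := C_NormedModule) (fun _ => RtoC 0)).
  + intros t. unfold extend. now destruct (Rlt_dec 0 (Re t)).
  + apply ex_derive_const.
- exists 0. intros _. rewrite Cmod_0. apply Rle_refl.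
- exists (fun _ => RtoC 0), 0. intros s _. unfold is_dirichlet_series.
  apply (is_series_ext (fun _ => scal (V := C_NormedModule) (RtoC 0) (RtoC 0))).
  + intros n. unfold scal; simpl. unfold mult; simpl. now rewrite !Cmult_0_l.
  + unfold is_series.
    apply (filterlim_ext (fun _ => RtoC 0)).
    * intros n. induction n as [|n IH].
      -- rewrite sum_O. symmetry. apply Cmult_0_l.
      -- rewrite sum_Sn, <- IH. unfold plus, scal; simpl. unfold mult; simpl.
         now rewrite Cmult_0_l, Cplus_0_l.
    * apply filterlim_const.
Defined.

Definition Hinf_plus (f g : Hinf) : Hinf.
Proof.
refine (mkHinf (fun s => Cplus (f s) (g s)) _ _ _).
- intros s.
  apply (ex_derive_ext (V := C_NormedModule)
    (fun z => plus (G := C_AbelianGroup) (extend f z) (extend g z))).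
  + intros z. unfold extend. destruct (Rlt_dec 0 (Re z)); [reflexivity|].
    exact (plus_zero_r (G := C_AbelianGroup) _).
  + exact (ex_derive_plus (V := C_NormedModule) _ _ _
      (Hinf_analytic f s) (Hinf_analytic g s)).
- destruct (Hinf_bounded f) as [M HM], (Hinf_bounded g) as [N HN].
  exists (M + N). intros s. eapply Rle_trans; [apply Cmod_triangle|].
  now apply Rplus_le_compat.
- destruct (Hinf_dirichlet f) as (a & x & Ha), (Hinf_dirichlet g) as (b & y & Hb).
  exists (fun n => Cplus (a n) (b n)), (Rmax x y). intros s Hs.
  unfold is_dirichlet_series.
  apply (is_series_ext (fun n => plus (G := C_AbelianGroup)
    (Cmult (a (S n)) (dirichlet_term (S n) s))
    (Cmult (b (S n)) (dirichlet_term (S n) s)))).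
  + intros n. symmetry. apply Cmult_plus_distr_r.
  + apply (is_series_plus (V := C_NormedModule)).
    * apply Ha. eapply Rle_lt_trans; [apply Rmax_l | exact Hs].
    * apply Hb. eapply Rle_lt_trans; [apply Rmax_r | exact Hs].
Defined.

Definition Hinf_scal (c : C) (f : Hinf) : Hinf.
Proof.
refine (mkHinf (fun s => Cmult c (f s)) _ _ _).
- intros s.
  apply (ex_derive_ext (V := C_NormedModule)
    (fun z => scal (V := C_NormedModule) c (extend f z))).
  + intros z. unfold extend. destruct (Rlt_dec 0 (Re z)); [reflexivity|].
    exact (Cmult_0_r c).
  + destruct (Hinf_analytic f s) as [l Hl].
    exists (scal (V := C_NormedModule) c l).
    eapply filterdiff_ext_lin.
    * apply (filterdiff_scal_r_fct (V := C_NormedModule)); [exact Cmult_comm|].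
      exact Hl.
    * intros y. exact (eq_trans (Cmult_assoc c y l)
        (eq_trans (f_equal (fun u => Cmult u l) (Cmult_comm c y))
           (eq_sym (Cmult_assoc y c l)))).
- destruct (Hinf_bounded f) as [M HM].
  exists (Cmod c * M). intros s. rewrite Cmod_mult.
  apply Rmult_le_compat_l; [apply Cmod_ge_0 | apply HM].
- destruct (Hinf_dirichlet f) as (a & x & Ha).
  exists (fun n => Cmult c (a n)), x. intros s Hs.
  apply (is_series_ext (fun n => scal (V := C_NormedModule) c
    (Cmult (a (S n)) (dirichlet_term (S n) s)))).
  + intros n. apply Cmult_assoc.
  + exact (is_series_scal (V := C_NormedModule) c _ _ (Ha s Hs)).
Defined.

Definition Hinf_opp (f : Hinf) : Hinf := Hinf_scal (Copp (RtoC 1)) f.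

Definition Hinf_AbelianMonoid_mixin : AbelianMonoid.mixin_of Hinf.
Proof.
refine (AbelianMonoid.Mixin Hinf Hinf_plus Hinf_zero _ _ _);
  intros; apply Hinf_ext; intros s; simpl.
- apply Cplus_comm.
- apply Cplus_assoc.
- apply Cplus_0_r.
Defined.

Canonical Hinf_AbelianMonoid :=
  AbelianMonoid.Pack Hinf Hinf_AbelianMonoid_mixin Hinf.

Definition Hinf_AbelianGroup_mixin : AbelianGroup.mixin_of Hinf_AbelianMonoid.
Proof.
refine (AbelianGroup.Mixin Hinf_AbelianMonoid Hinf_opp _).
intros f; apply Hinf_ext; intros s; simpl. ring.
Defined.

Canonical Hinf_AbelianGroup :=
  AbelianGroup.Pack Hinf
    (AbelianGroup.Class _ Hinf_AbelianMonoid_mixin Hinf_AbelianGroup_mixin) Hinf.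

Definition Hinf_ModuleSpace_mixin : ModuleSpace.mixin_of C_Ring Hinf_AbelianGroup.
Proof.
refine (ModuleSpace.Mixin C_Ring Hinf_AbelianGroup Hinf_scal _ _ _ _);
  intros; apply Hinf_ext; intros s; simpl.
- apply Cmult_assoc.
- apply Cmult_1_l.
- apply Cmult_plus_distr_l.
- apply Cmult_plus_distr_r.
Defined.

Canonical Hinf_ModuleSpace :=
  ModuleSpace.Pack C_Ring Hinf
    (ModuleSpace.Class _ _ (AbelianGroup.class _) Hinf_ModuleSpace_mixin) Hinf.

Lemma Hinf_norm_triangle (f g : Hinf) :
  Hinf_norm (plus f g) <= Hinf_norm f + Hinf_norm g.
Proof.
apply Hinf_norm_le. intros s. eapply Rle_trans; [apply Cmod_triangle|].
apply Rplus_le_compat; apply Hinf_norm_ub.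
Qed.

Lemma Hinf_norm_scal (c : C) (f : Hinf) :
  Hinf_norm (scal c f) <= Cmod c * Hinf_norm f.
Proof.
apply Hinf_norm_le. intros s. simpl. rewrite Cmod_mult.
apply Rmult_le_compat_l; [apply Cmod_ge_0 | apply Hinf_norm_ub].
Qed.

Lemma Hinf_norm_eq_0 (f : Hinf) : Hinf_norm f = 0 -> f = zero.
Proof.
intros H. apply Hinf_ext. intros s. apply Cmod_eq_0, Rle_antisym.
- rewrite <- H. apply Hinf_norm_ub.
- apply Cmod_ge_0.
Qed.

Definition Hinf_UniformSpace_mixin : UniformSpace.mixin_of Hinf.
Proof.
refine (UniformSpace.Mixin Hinf zero
  (fun f e g => Hinf_norm (minus g f) < e) _ _ _).
- intros f e. rewrite minus_eq_zero.
  apply Rle_lt_trans with 0; [|apply cond_pos].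
  apply Hinf_norm_le. intros s. simpl. rewrite Cmod_0. apply Rle_refl.
- intros f g e H. eapply Rle_lt_trans; [|exact H].
  apply Hinf_norm_le. intros s.
  replace (minus f g s) with (Copp (minus g f s)) by (simpl; ring).
  rewrite Cmod_opp. apply Hinf_norm_ub.
- intros f g h d e H1 H2. rewrite (minus_trans g h f), (Rplus_comm d e).
  eapply Rle_lt_trans; [apply Hinf_norm_triangle|].
  now apply Rplus_lt_compat.
Defined.

Canonical Hinf_UniformSpace :=
  UniformSpace.Pack Hinf Hinf_UniformSpace_mixin Hinf.

Canonical Hinf_NormedModuleAux :=
  NormedModuleAux.Pack C_AbsRing Hinf
    (NormedModuleAux.Class C_AbsRing _
      (ModuleSpace.class C_Ring Hinf_ModuleSpace) Hinf_UniformSpace_mixin) Hinf.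

Definition Hinf_NormedModule_mixin :
  NormedModule.mixin_of C_AbsRing Hinf_NormedModuleAux.
Proof.
refine (NormedModule.Mixin C_AbsRing Hinf_NormedModuleAux Hinf_norm 1
  Hinf_norm_triangle Hinf_norm_scal _ _ Hinf_norm_eq_0).
- intros f g e H. exact H.
- intros f g e H. rewrite Rmult_1_l. exact H.
Defined.

Canonical Hinf_NormedModule :=
  NormedModule.Pack C_AbsRing Hinf
    (NormedModule.Class C_AbsRing _ _ Hinf_NormedModule_mixin) Hinf.

(** * Semigroups of composition operators *)

(* In Coquelicot, [is_linear] means linear and bounded.  Only the operators
   [T t] with [0 <= t] belong to the family. *)
Definition semigroup {X : NormedModule C_AbsRing} (T : R -> X -> X) : Prop :=
  (forall t, 0 <= t -> is_linear (T t)) /\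
  (forall f, T 0 f = f) /\
  (forall t u, 0 <= t -> 0 <= u -> forall f, T t (T u f) = T (t + u) f).

Definition strongly_continuous_semigroup {X : NormedModule C_AbsRing}
    (T : R -> X -> X) : Prop :=
  semigroup T /\
  forall f : X, filterlim (fun t => T t f) (at_right 0) (locally f).

Definition composition_operator (A : Hinf -> Hinf) : Prop :=
  is_linear A /\
  exists Phi : half_plane -> half_plane,
    analytic (fun s => Phi s) /\
    forall (f : Hinf) (s : half_plane), A f s = f (Phi s).

(* Main.v *)
(** Write [z_t(s) = n^{-Phi_t(s)}] for the image of the monomial [n^{-s}] under
    [T t].  For real [tau] the function [f_tau(s) = (1 - n^{-(s - i tau)})^i] belongs
    to [H^infinity], is bounded away from 0, and oscillates at the boundary point
    [i tau].  If [T t f_tau] is uniformly close to [f_tau], then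
    [ln |1 - n^{i tau} z_t| - ln |1 - n^{i tau} n^{-s}|] avoids the values [PI] and
    [- PI], hence stays between them by connectedness, and
    [|z_t(s) - n^{-s}| <= C |1 - n^{-(s - i tau)}|] on the whole half-plane.  By Baire's
    theorem a single time bound serves a set of [tau] that is dense in an interval,
    so that for small [t] the bounded analytic function [z_t(s) - n^{-s}] has zero
    boundary values on that interval; thus it vanishes identically.  Taking [n = 2]
    and [n = 3] gives [Phi_t(s) = s], because [ln 3 / ln 2] is irrational. *)

Require Import Defs.
From Stdlib Require Import Reals Ranalysis5 Lra Lia ZArith ClassicalEpsilon
  ProofIrrelevance.
From Coquelicot Require Import Coquelicot.

Open Scope R_scope.

(** * Complex differentiability *)

(** Strong continuity handles one function at a time and only makes sup norms small; closeness of
    [z_t] to [n^{-s}] alone would never give equality. The imaginary power [(1 - w)^i] turns the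
    logarithmic distance to a boundary point into a phase: at a log difference of [PI] or [- PI] the
    two values are negative multiples of each other, hence at least [exp (- (PI / 2))] apart.
    Neither this threshold nor the resulting constant [exp PI] depends on [tau], so a dense set of
    [tau] is enough: given [z], a [tau] within [Re z] of [Im z] yields a bound [K * Re z]. This
    linear bound on a half-strip is the form in which zero boundary values are used. In the
    logarithmic coordinate of the disc, uniqueness then reduces to the invariance of the mean of a
    periodic function over vertical segments, which is Goursat's lemma on a rectangle of height
    [2 * PI]. The time bound may depend on [n], which is harmless because only [n = 2] and [n = 3]
    occur. *)

Definition cdiff (f : C -> C) (z l : C) : Prop :=
  forall eps, 0 < eps -> exists delta, 0 < delta /\
    forall w : C, Cmod (w - z) < delta ->
      Cmod (f w - f z - l * (w - z)) <= eps * Cmod (w - z).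

Lemma is_derive_cdiff (f : C -> C) (z l : C) :
  is_derive (K := C_AbsRing) (V := C_NormedModule) f z l <-> cdiff f z l.
Proof.
split.
- intros [_ H] eps Heps.
  destruct (H z (fun P HP => HP) (mkposreal eps Heps)) as [d Hd].
  exists d; split; [apply cond_pos|]. intros w Hw.
  rewrite (Cmult_comm l). exact (Hd w Hw).
- intros H. split; [apply is_linear_scal_l|].
  intros x Hx [eps Heps].
  rewrite <- (is_filter_lim_locally_unique (V := AbsRing_NormedModule C_AbsRing) z x Hx).
  destruct (H eps Heps) as (d & Hd & Hw).
  exists (mkposreal d Hd). intros w Hwd.
  specialize (Hw w Hwd). rewrite (Cmult_comm l) in Hw. exact Hw.
Qed.

Lemma im_Cmod (z : C) : Rabs (Im z) <= Cmod z.
Proof. eapply Rle_trans; [apply Rmax_r | apply (Rmax_Cmod z)]. Qed.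

Lemma Cmod_le_abs (z : C) : Cmod z <= Rabs (Re z) + Rabs (Im z).
Proof.
destruct z as [x y]; simpl.
replace ((x, y) : C) with (RtoC x + Ci * RtoC y)%C
  by (unfold RtoC, Ci, Cplus, Cmult; simpl; f_equal; ring).
eapply Rle_trans; [apply Cmod_triangle|].
rewrite Cmod_mult, Cmod_Ci, !Cmod_R. lra.
Qed.

Lemma Cmod_sub_sym (z w : C) : Cmod (z - w) = Cmod (w - z).
Proof. rewrite <- Cmod_opp. f_equal. ring. Qed.

Lemma Cmod_triangle_sub (z w : C) : Cmod z <= Cmod w + Cmod (z - w).
Proof.
replace z with (w + (z - w))%C at 1 by ring. apply Cmod_triangle.
Qed.

Lemma cdiff_bound (f : C -> C) (z l : C) : cdiff f z l ->
  exists delta, 0 < delta /\ forall w : C, Cmod (w - z) < delta ->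
    Cmod (f w - f z) <= (Cmod l + 1) * Cmod (w - z).
Proof.
intros H. destruct (H 1 Rlt_0_1) as (d & Hd & Hw).
exists d; split; [exact Hd|]. intros w Hwd. specialize (Hw w Hwd).
eapply Rle_trans; [apply (Cmod_triangle_sub _ (l * (w - z)))|].
rewrite Cmod_mult. lra.
Qed.

Definition ccont (f : C -> C) (z : C) : Prop :=
  forall eps, 0 < eps -> exists delta, 0 < delta /\
    forall w : C, Cmod (w - z) < delta -> Cmod (f w - f z) < eps.

Lemma cdiff_ccont (f : C -> C) (z l : C) : cdiff f z l -> ccont f z.
Proof.
intros H eps Heps. destruct (cdiff_bound f z l H) as (d & Hd & Hw).
pose proof (Cmod_ge_0 l) as Hl.
exists (Rmin d (eps / (Cmod l + 1))). split.
- apply Rmin_pos; [exact Hd|]. apply Rdiv_lt_0_compat; lra.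
- intros w Hwd.
  assert (H1 := Rlt_le_trans _ _ _ Hwd (Rmin_l _ _)).
  assert (H2 := Rlt_le_trans _ _ _ Hwd (Rmin_r _ _)).
  eapply Rle_lt_trans; [exact (Hw w H1)|].
  apply (Rmult_lt_compat_l (Cmod l + 1)) in H2; [|lra].
  replace ((Cmod l + 1) * (eps / (Cmod l + 1))) with eps in H2 by (field; lra).
  exact H2.
Qed.

Lemma cdiff_ext_near (f g : C -> C) (z l : C) (r : R) :
  0 < r -> (forall w : C, Cmod (w - z) < r -> f w = g w) ->
  cdiff f z l -> cdiff g z l.
Proof.
intros Hr E H eps Heps. destruct (H eps Heps) as (d & Hd & Hw).
exists (Rmin d r). split; [now apply Rmin_pos|]. intros w Hwd.
rewrite <- !E.
- apply Hw. eapply Rlt_le_trans; [exact Hwd | apply Rmin_l].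
- replace (z - z)%C with (RtoC 0) by ring. now rewrite Cmod_0.
- eapply Rlt_le_trans; [exact Hwd | apply Rmin_r].
Qed.

Lemma cdiff_const (c z : C) : cdiff (fun _ => c) z 0.
Proof.
intros eps Heps. exists 1. split; [lra|]. intros w _.
replace (c - c - 0 * (w - z))%C with (RtoC 0) by ring.
rewrite Cmod_0. apply Rmult_le_pos; [lra | apply Cmod_ge_0].
Qed.

Lemma cdiff_id (z : C) : cdiff (fun w => w) z 1.
Proof.
intros eps Heps. exists 1. split; [lra|]. intros w _.
replace (w - z - 1 * (w - z))%C with (RtoC 0) by ring.
rewrite Cmod_0. apply Rmult_le_pos; [lra | apply Cmod_ge_0].
Qed.

Lemma cdiff_plus (f g : C -> C) (z l m : C) :
  cdiff f z l -> cdiff g z m -> cdiff (fun w => f w + g w)%C z (l + m)%C.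
Proof.
intros Hf Hg eps Heps.
destruct (Hf (eps / 2)) as (d & Hd & Hw); [lra|].
destruct (Hg (eps / 2)) as (e & He & Hv); [lra|].
exists (Rmin d e). split; [now apply Rmin_pos|]. intros w Hwd.
assert (H1 := Hw w (Rlt_le_trans _ _ _ Hwd (Rmin_l _ _))).
assert (H2 := Hv w (Rlt_le_trans _ _ _ Hwd (Rmin_r _ _))).
replace (f w + g w - (f z + g z) - (l + m) * (w - z))%C
  with ((f w - f z - l * (w - z)) + (g w - g z - m * (w - z)))%C by ring.
eapply Rle_trans; [apply Cmod_triangle|]. lra.
Qed.

Lemma cdiff_comp (f g : C -> C) (z l m : C) :
  cdiff f z l -> cdiff g (f z) m -> cdiff (fun w => g (f w)) z (m * l)%C.
Proof.
intros Hf Hg eps Heps.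
pose proof (Cmod_ge_0 l) as Hl. pose proof (Cmod_ge_0 m) as Hm.
assert (He1 : 0 < eps / (2 * (Cmod l + 1))) by (apply Rdiv_lt_0_compat; lra).
assert (He2 : 0 < eps / (2 * (Cmod m + 1))) by (apply Rdiv_lt_0_compat; lra).
destruct (Hg _ He1) as (e & He & Hv).
destruct (Hf _ He2) as (d & Hd & Hw).
destruct (cdiff_bound f z l Hf) as (b & Hb & Hwb).
destruct (cdiff_ccont f z l Hf e He) as (c & Hc & Hwc).
exists (Rmin (Rmin d b) c). split; [repeat apply Rmin_pos; assumption|].
intros w Hwd.
assert (H1 : Cmod (w - z) < d).
{ eapply Rlt_le_trans; [exact Hwd|]. eapply Rle_trans; apply Rmin_l. }
assert (H2 : Cmod (w - z) < b).
{ eapply Rlt_le_trans; [exact Hwd|].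
  eapply Rle_trans; [apply Rmin_l | apply Rmin_r]. }
assert (H3 := Rlt_le_trans _ _ _ Hwd (Rmin_r _ _)).
specialize (Hw w H1). specialize (Hwb w H2).
specialize (Hv (f w) (Hwc w H3)).
replace (g (f w) - g (f z) - m * l * (w - z))%C
  with ((g (f w) - g (f z) - m * (f w - f z)) + m * (f w - f z - l * (w - z)))%C
  by ring.
eapply Rle_trans; [apply Cmod_triangle|]. rewrite Cmod_mult.
set (h := Cmod (w - z)) in *. pose proof (Cmod_ge_0 (w - z)) as Hh. fold h in Hh.
assert (A1 : eps / (2 * (Cmod l + 1)) * Cmod (f w - f z) <= eps / 2 * h).
{ apply Rle_trans with (eps / (2 * (Cmod l + 1)) * ((Cmod l + 1) * h)).
  - apply Rmult_le_compat_l; lra.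
  - right. field. lra. }
assert (A2 : Cmod m * Cmod (f w - f z - l * (w - z)) <= eps / 2 * h).
{ apply Rle_trans with ((Cmod m + 1) * (eps / (2 * (Cmod m + 1)) * h)).
  - apply Rmult_le_compat; try lra. apply Cmod_ge_0.
  - right. field. lra. }
lra.
Qed.

Lemma cdiff_square (z : C) : cdiff (fun w => w * w)%C z (z + z)%C.
Proof.
intros eps Heps. exists eps. split; [exact Heps|]. intros w Hw.
replace (w * w - z * z - (z + z) * (w - z))%C with ((w - z) * (w - z))%C by ring.
rewrite Cmod_mult. apply Rmult_le_compat_r; [apply Cmod_ge_0 | lra].
Qed.

Lemma cdiff_scal (c : C) (f : C -> C) (z l : C) :
  cdiff f z l -> cdiff (fun w => c * f w)%C z (c * l)%C.
Proof.
intros Hf. apply (cdiff_comp f (fun w => c * w)%C z l c Hf).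
intros eps Heps. exists 1. split; [lra|]. intros w _.
replace (c * w - c * f z - c * (w - f z))%C with (RtoC 0) by ring.
rewrite Cmod_0. apply Rmult_le_pos; [lra | apply Cmod_ge_0].
Qed.

Lemma cdiff_eq (f : C -> C) (z l m : C) : cdiff f z l -> l = m -> cdiff f z m.
Proof. now intros H <-. Qed.

(* By polarization from the square: [4 f g = (f + g)^2 - (f - g)^2]. *)
Lemma cdiff_mult (f g : C -> C) (z l m : C) :
  cdiff f z l -> cdiff g z m ->
  cdiff (fun w => f w * g w)%C z (l * g z + f z * m)%C.
Proof.
intros Hf Hg.
set (q := RtoC (/ 4)).
assert (Hq : forall x : C, (q * (x + x + x + x) = x)%C).
{ intros x. replace (q * (x + x + x + x))%C with ((q + q + q + q) * x)%C by ring.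
  unfold q. rewrite <- !RtoC_plus.
  replace (/ 4 + / 4 + / 4 + / 4) with 1 by lra. ring. }
apply (cdiff_ext_near (fun w => q * ((f w + g w) * (f w + g w)
  + - (1) * ((f w + - (1) * g w) * (f w + - (1) * g w))))%C _ _ _ 1); [lra| |].
{ intros w _. rewrite <- (Hq (f w * g w)%C). ring. }
eapply cdiff_eq.
- apply (cdiff_scal q), cdiff_plus.
  + eapply (cdiff_comp (fun w => f w + g w)%C (fun w => w * w)%C).
    * exact (cdiff_plus _ _ _ _ _ Hf Hg).
    * apply cdiff_square.
  + apply (cdiff_scal (- (1))%C).
    eapply (cdiff_comp (fun w => f w + - (1) * g w)%C (fun w => w * w)%C).
    * exact (cdiff_plus _ _ _ _ _ Hf (cdiff_scal _ _ _ _ Hg)).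
    * apply cdiff_square.
- rewrite <- (Hq (l * g z + f z * m)%C). ring.
Qed.

(** The remainder is exactly [(w - z)^2 / (w z^2)]. One radius keeps [|w| >= |z| / 2], the other
    makes [|w - z|] at most [eps |w| |z|^2]. *)
Lemma cdiff_inv (z : C) : z <> 0 -> cdiff (fun w => / w)%C z (- / (z * z))%C.
Proof.
intros Hz. pose proof (proj1 (Cmod_gt_0 z) Hz) as Hm.
intros eps Heps.
exists (Rmin (Cmod z / 2) (eps * Cmod z * Cmod z * Cmod z / 2)). split.
- apply Rmin_pos; [lra|]. repeat apply Rmult_lt_0_compat; lra.
- intros w Hwd.
  assert (H1 := Rlt_le_trans _ _ _ Hwd (Rmin_l _ _)).
  assert (H2 := Rlt_le_trans _ _ _ Hwd (Rmin_r _ _)).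
  assert (Hw : Cmod z / 2 <= Cmod w).
  { pose proof (Cmod_triangle_sub z w) as H. rewrite Cmod_sub_sym in H. lra. }
  assert (Hw0 : w <> 0) by (apply Cmod_gt_0; lra).
  replace (/ w - / z - - / (z * z) * (w - z))%C
    with ((w - z) * (w - z) / (w * (z * z)))%C by (field; now split).
  rewrite Cmod_div by (repeat apply Cmult_neq_0; assumption).
  rewrite !Cmod_mult. set (h := Cmod (w - z)) in *.
  pose proof (Cmod_ge_0 (w - z)) as Hh. fold h in Hh.
  apply Rle_div_l; [repeat apply Rmult_lt_0_compat; lra|].
  replace (eps * h * (Cmod w * (Cmod z * Cmod z)))
    with (h * (eps * Cmod w * (Cmod z * Cmod z))) by ring.
  apply Rmult_le_compat_l; [exact Hh|].
  apply Rlt_le, (Rlt_le_trans _ _ _ H2).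
  apply Rle_trans with (eps * (Cmod z / 2) * (Cmod z * Cmod z)); [right; field|].
  apply Rmult_le_compat_r; [apply Rmult_le_pos; lra|].
  apply Rmult_le_compat_l; lra.
Qed.

(** * Complex exponential and logarithm *)

Lemma Cexp_plus (z w : C) : Cexp (z + w) = (Cexp z * Cexp w)%C.
Proof.
destruct z as [a b], w as [c d]. unfold Cexp, Cplus, Cmult; simpl.
rewrite exp_plus, cos_plus, sin_plus. f_equal; ring.
Qed.

Lemma Cexp_0 : Cexp 0 = 1.
Proof.
unfold Cexp; simpl. rewrite exp_0, cos_0, sin_0. unfold RtoC. f_equal; ring.
Qed.

Lemma Cmod_Cexp (z : C) : Cmod (Cexp z) = exp (Re z).
Proof.
unfold Cmod, Cexp; simpl.
replace (_ + _) with (exp (Re z) * exp (Re z) * (Rsqr (sin (Im z)) + Rsqr (cos (Im z))))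
  by (unfold Rsqr; ring).
rewrite sin2_cos2, Rmult_1_r. apply sqrt_square, Rlt_le, exp_pos.
Qed.

Lemma Cexp_opp (z : C) : (Cexp z * Cexp (- z) = 1)%C.
Proof. rewrite <- Cexp_plus, <- Cexp_0. f_equal. ring. Qed.

Lemma derivable_pt_lim_bound (f : R -> R) (x l : R) : derivable_pt_lim f x l ->
  forall eps, 0 < eps -> exists delta, 0 < delta /\
    forall h, Rabs h < delta -> Rabs (f (x + h) - f x - l * h) <= eps * Rabs h.
Proof.
intros H eps Heps. destruct (H eps Heps) as [d Hd].
exists d; split; [apply cond_pos|]. intros h Hh.
destruct (Req_dec h 0) as [-> | Hn].
- replace (f (x + 0) - f x - l * 0) with 0 by (rewrite Rplus_0_r; ring).
  rewrite Rabs_R0. lra.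
- specialize (Hd h Hn Hh). apply Rlt_le in Hd.
  apply (Rmult_le_compat_r (Rabs h)) in Hd; [|apply Rabs_pos].
  rewrite <- Rabs_mult in Hd.
  now replace (((f (x + h) - f x) / h - l) * h) with (f (x + h) - f x - l * h)
    in Hd by (field; exact Hn).
Qed.

(** The real derivatives of [exp], [cos] and [sin] enter only at 0; the addition formula moves the
    result to every point. *)
Lemma cdiff_Cexp_0 : cdiff Cexp 0 1.
Proof.
intros eps0 Heps0.
(* Each coordinate will cost [3 * eps * m], so a tenth of [eps0] suffices. The cap 1 gives
   [|exp x - 1| <= 2 |x|] and [exp x <= 2]; the radius [eps / 2] below absorbs the cross term
   [(exp x - 1) * y]. *)
set (eps := Rmin (eps0 / 10) 1).
assert (Heps : 0 < eps) by (apply Rmin_pos; lra).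
assert (Hle : eps <= eps0 / 10) by apply Rmin_l.
assert (Hle1 : eps <= 1) by apply Rmin_r.
destruct (derivable_pt_lim_bound exp 0 1) with eps as (d1 & Hd1 & H1);
  [generalize (derivable_pt_lim_exp 0); now rewrite exp_0 | exact Heps |].
destruct (derivable_pt_lim_bound cos 0 (- sin 0)) with eps as (d2 & Hd2 & H2);
  [apply derivable_pt_lim_cos | exact Heps |].
destruct (derivable_pt_lim_bound sin 0 (cos 0)) with eps as (d3 & Hd3 & H3);
  [apply derivable_pt_lim_sin | exact Heps |].
exists (Rmin (Rmin d1 d2) (Rmin d3 (eps / 2))).
split; [repeat apply Rmin_pos; lra|].
intros w Hw. rewrite Cexp_0.
replace (w - 0)%C with w in * by ring.
destruct w as [x y].
pose proof (re_le_Cmod (x, y)) as Hx. pose proof (im_Cmod (x, y)) as Hy. simpl in Hx, Hy.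
set (m := Cmod (x, y)) in *.
pose proof (Rmin_l (Rmin d1 d2) (Rmin d3 (eps / 2))).
pose proof (Rmin_r (Rmin d1 d2) (Rmin d3 (eps / 2))).
pose proof (Rmin_l d1 d2). pose proof (Rmin_r d1 d2).
pose proof (Rmin_l d3 (eps / 2)). pose proof (Rmin_r d3 (eps / 2)).
specialize (H1 x ltac:(lra)). specialize (H2 y ltac:(lra)). specialize (H3 y ltac:(lra)).
rewrite Rplus_0_l, exp_0 in H1.
rewrite Rplus_0_l, cos_0, sin_0 in H2.
rewrite Rplus_0_l, cos_0, sin_0 in H3.
replace (cos y - 1 - - 0 * y) with (cos y - 1) in H2 by ring.
replace (sin y - 0 - 1 * y) with (sin y - y) in H3 by ring.
pose proof (Rabs_pos x). pose proof (Rabs_pos y).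
assert (Em : Rabs (exp x - 1) <= 2 * Rabs x).
{ replace (exp x - 1) with ((exp x - 1 - 1 * x) + x) by ring.
  eapply Rle_trans; [apply Rabs_triang|]. nra. }
assert (E3 : Rabs (exp x) <= 2).
{ replace (exp x) with ((exp x - 1) + 1) by ring.
  eapply Rle_trans; [apply Rabs_triang|]. rewrite Rabs_R1. nra. }
eapply Rle_trans; [apply Cmod_le_abs|].
unfold Cexp; simpl.
replace (exp x * cos y + - (1) + - (1 * x - 0 * y))
  with ((exp x - 1 - 1 * x) + exp x * (cos y - 1)) by ring.
replace (exp x * sin y + - 0 + - (1 * y + 0 * x))
  with (exp x * (sin y - y) + (exp x - 1) * y) by ring.
assert (B1 : Rabs ((exp x - 1 - 1 * x) + exp x * (cos y - 1)) <= 3 * (eps * m)).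
{ eapply Rle_trans; [apply Rabs_triang|]. rewrite (Rabs_mult (exp x)).
  pose proof (Rabs_pos (cos y - 1)). pose proof (Rabs_pos (exp x)). nra. }
assert (B2 : Rabs (exp x * (sin y - y) + (exp x - 1) * y) <= 3 * (eps * m)).
{ eapply Rle_trans; [apply Rabs_triang|]. rewrite !Rabs_mult.
  pose proof (Rabs_pos (sin y - y)). pose proof (Rabs_pos (exp x)).
  pose proof (Rabs_pos (exp x - 1)). nra. }
assert (0 <= m) by lra. nra.
Qed.

Lemma cdiff_Cexp (z : C) : cdiff Cexp z (Cexp z).
Proof.
apply (cdiff_ext_near (fun w => Cexp z * Cexp (w + - z))%C _ _ _ 1); [lra| |].
{ intros w _. rewrite <- Cexp_plus. f_equal. ring. }
eapply cdiff_eq.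
- apply cdiff_scal. apply (cdiff_comp (fun w => w + - z)%C Cexp).
  + apply cdiff_plus; [apply cdiff_id | apply cdiff_const].
  + replace (z + - z)%C with (RtoC 0) by ring. apply cdiff_Cexp_0.
- simpl. ring.
Qed.

(** * The principal logarithm on the right half-plane *)

Definition Clog (z : C) : C := (ln (Cmod z), atan (Im z / Re z)).

Lemma Cexp_Clog (z : C) : 0 < Re z -> Cexp (Clog z) = z.
Proof.
intros Hz. destruct z as [x y]. simpl in Hz. unfold Cexp, Clog; simpl.
assert (Hm : 0 < Cmod (x, y)).
{ apply Cmod_gt_0. intros E. inversion E. lra. }
rewrite exp_ln, cos_atan, sin_atan by exact Hm.
assert (Hs : Cmod (x, y) = x * sqrt (1 + (y / x)²)).
{ transitivity (sqrt (x * x) * sqrt (1 + (y / x)²)).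
  - pose proof (Rle_0_sqr (y / x)). rewrite <- sqrt_mult; [|nra|lra].
    unfold Cmod; simpl. f_equal. unfold Rsqr. field. lra.
  - rewrite sqrt_square; lra. }
rewrite Hs.
assert (sqrt (1 + (y / x)²) <> 0).
{ intros E. rewrite E in Hs. lra. }
f_equal; field; lra.
Qed.

Lemma Cmod_pos_Re (z : C) : 0 < Re z -> 0 < Cmod z.
Proof. intros H. pose proof (re_le_Cmod z). pose proof (Rle_abs (Re z)). lra. Qed.

Lemma ccont_Clog (z : C) : 0 < Re z -> ccont Clog z.
Proof.
intros Hz eps Heps.
pose proof (Cmod_pos_Re z Hz) as Hm.
assert (Hln : continuity_pt ln (Cmod z)).
{ apply derivable_continuous_pt. exists (/ Cmod z).
  now apply derivable_pt_lim_ln. }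
assert (Hat : continuity_pt atan (Im z / Re z)).
{ apply derivable_continuous_pt, derivable_pt_atan. }
destruct (Hln (eps / 2)) as (d1 & Hd1 & H1); [lra|].
destruct (Hat (eps / 2)) as (d2 & Hd2 & H2); [lra|].
simpl in H1, H2. unfold R_dist, D_x, no_cond in H1, H2.
assert (H1' : forall u, Rabs (u - Cmod z) < d1 -> Rabs (ln u - ln (Cmod z)) < eps / 2).
{ intros u Hu. destruct (Req_dec (Cmod z) u) as [-> | Hn].
  - rewrite Rminus_diag, Rabs_R0. lra.
  - now apply H1. }
assert (H2' : forall u, Rabs (u - Im z / Re z) < d2 ->
  Rabs (atan u - atan (Im z / Re z)) < eps / 2).
{ intros u Hu. destruct (Req_dec (Im z / Re z) u) as [<- | Hn].
  - rewrite Rminus_diag, Rabs_R0. lra.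
  - now apply H2. }
clear H1 H2.
(* With [x = Re z] and [u = Re w > x / 2], the slope [Im / Re] moves by at most
   [|w - z| (x + |Im z|) / (u x)]; [k] is the reciprocal of a Lipschitz constant that this
   yields. *)
set (k := Re z * Re z / 2 / (Re z + Rabs (Im z) + 1)).
pose proof (Rabs_pos (Im z)) as Hi.
assert (Hk : 0 < k) by (repeat apply Rdiv_lt_0_compat; nra).
exists (Rmin (Rmin d1 (Re z / 2)) (d2 * k)). split.
{ repeat apply Rmin_pos; nra. }
intros w Hw.
pose proof (Rmin_l (Rmin d1 (Re z / 2)) (d2 * k)).
pose proof (Rmin_r (Rmin d1 (Re z / 2)) (d2 * k)).
pose proof (Rmin_l d1 (Re z / 2)). pose proof (Rmin_r d1 (Re z / 2)).
eapply Rle_lt_trans; [apply Cmod_le_abs|].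
replace eps with (eps / 2 + eps / 2) by field.
pose proof (re_le_Cmod (w - z)) as Hre. pose proof (im_Cmod (w - z)) as Him.
destruct z as [x y], w as [u v]. simpl in *.
set (h := Cmod ((u, v) - (x, y))) in *.
apply Rplus_lt_compat.
- apply H1'. pose proof (Cmod_triangle_sub (u, v) (x, y)) as T1.
  pose proof (Cmod_triangle_sub (x, y) (u, v)) as T2.
  rewrite Cmod_sub_sym in T2. fold h in T1, T2.
  apply Rabs_def1; lra.
- apply H2'.
  assert (Hu : x / 2 < u).
  { apply Rabs_le_between in Hre. lra. }
  replace (v / u - y / x) with (((v + - y) * x - y * (u + - x)) / (u * x)) by (field; lra).
  unfold Rdiv. rewrite Rabs_mult, (Rabs_right (/ (u * x)))
    by (apply Rle_ge, Rlt_le, Rinv_0_lt_compat; nra).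
  apply Rlt_div_l; [nra|].
  eapply Rle_lt_trans.
  { unfold Rminus. apply Rabs_triang. }
  rewrite Rabs_Ropp, !Rabs_mult, (Rabs_right x) by lra.
  assert (Hhk : h * (x + Rabs y + 1) < d2 * (x * x / 2)).
  { replace (d2 * (x * x / 2)) with (d2 * k * (x + Rabs y + 1))
      by (unfold k; simpl; field; lra).
    apply Rmult_lt_compat_r; lra. }
  assert (d2 * (x * x / 2) <= d2 * (u * x)) by (apply Rmult_le_compat_l; nra).
  pose proof (Rmult_le_compat_r x _ _ ltac:(lra) Him).
  pose proof (Rmult_le_compat_l (Rabs y) _ _ Hi Hre).
  pose proof (Cmod_ge_0 ((u, v) - (x, y))%C) as Hh. fold h in Hh. nra.
Qed.

(* [Clog] inverts [Cexp] continuously, so its difference quotients are the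
   inverses of those of [Cexp]. *)
Lemma cdiff_Clog (z : C) : 0 < Re z -> cdiff Clog z (/ z)%C.
Proof.
intros Hz eps Heps.
pose proof (Cmod_pos_Re z Hz) as Hm.
assert (Hz0 : z <> 0) by now apply Cmod_gt_0.
(* The bound [Cmod z / 2] lets [e |q|] be absorbed, giving [|z| |q| <= 2 |w - z|]; the first bound
   then makes the remainder [e |q| / |z|] at most [eps |w - z|]. *)
set (e := Rmin (eps * Cmod z * Cmod z / 2) (Cmod z / 2)).
assert (He : 0 < e).
{ apply Rmin_pos; [|lra]. repeat apply Rmult_lt_0_compat; lra. }
destruct (cdiff_Cexp (Clog z) e He) as (d & Hd & HE).
destruct (ccont_Clog z Hz d Hd) as (b & Hb & HL).
exists (Rmin b (Re z)). split; [now apply Rmin_pos|].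
intros w Hw.
assert (W1 := Rlt_le_trans _ _ _ Hw (Rmin_l _ _)).
assert (W2 := Rlt_le_trans _ _ _ Hw (Rmin_r _ _)).
assert (Hrw : 0 < Re w).
{ pose proof (re_le_Cmod (w - z)) as H. change (Re (w - z)) with (Re w - Re z) in H.
  apply Rabs_le_between in H. lra. }
specialize (HE (Clog w) (HL w W1)). rewrite !Cexp_Clog in HE by assumption.
set (q := (Clog w - Clog z)%C) in *.
assert (He1 : e <= eps * Cmod z * Cmod z / 2) by apply Rmin_l.
assert (He2 : e <= Cmod z / 2) by apply Rmin_r.
pose proof (Cmod_ge_0 q) as Hq.
assert (Q : Cmod z * Cmod q <= 2 * Cmod (w - z)).
{ assert (H : Cmod (z * q) <= Cmod (w - z) + e * Cmod q).
  { replace (z * q)%C with ((w - z) + - (w - z - z * q))%C by ring.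
    eapply Rle_trans; [apply Cmod_triangle|]. rewrite Cmod_opp. lra. }
  rewrite Cmod_mult in H. nra. }
replace (q - / z * (w - z))%C with (- (w - z - z * q) / z)%C by (field; exact Hz0).
rewrite Cmod_div, Cmod_opp by exact Hz0.
apply Rle_div_l; [exact Hm|].
eapply Rle_trans; [exact HE|].
apply Rle_trans with (eps * Cmod z * Cmod z / 2 * Cmod q).
- now apply Rmult_le_compat_r.
- pose proof (Rmult_le_compat_l (eps * Cmod z / 2) _ _ ltac:(nra) Q). lra.
Qed.

(** * Goursat's lemma for rectangles *)

(** Used both for shrinking rectangles in Goursat's argument and for the Baire argument on the
    line. *)
Lemma nested_intervals (a b : nat -> R) :
  (forall n, a n <= a (S n)) -> (forall n, b (S n) <= b n) ->
  (forall n, a n <= b n) -> exists x, forall n, a n <= x <= b n.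
Proof.
intros Ha Hb Hab.
assert (Ha' : forall n m, (n <= m)%nat -> a n <= a m).
{ intros n m H. induction H as [|m H IH]; [apply Rle_refl|].
  eapply Rle_trans; [exact IH | apply Ha]. }
assert (Hb' : forall n m, (n <= m)%nat -> b m <= b n).
{ intros n m H. induction H as [|m H IH]; [apply Rle_refl|].
  eapply Rle_trans; [apply Hb | exact IH]. }
assert (Hub : forall n, is_upper_bound (fun r => exists k, r = a k) (b n)).
{ intros n r [k ->].
  apply Rle_trans with (a (max n k)); [apply Ha'; lia|].
  apply Rle_trans with (b (max n k)); [apply Hab | apply Hb'; lia]. }
destruct (completeness (fun r => exists k, r = a k)) as [x [Hx1 Hx2]].
- exists (b 0%nat). apply Hub.
- now exists (a 0%nat), 0%nat.
- exists x. intros n. split.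
  + apply Hx1. now exists n.
  + apply Hx2, Hub.
Qed.

Lemma dependent_choice {X : Type} (step : nat -> X -> X -> Prop) (x0 : X) :
  (forall n x, exists y, step n x y) ->
  exists u : nat -> X, u 0%nat = x0 /\ forall n, step n (u n) (u (S n)).
Proof.
intros H.
exists (fix u n := match n with
  | 0%nat => x0
  | S n => proj1_sig (constructive_indefinite_description _ (H n (u n)))
  end).
split; [reflexivity|]. intros n. apply proj2_sig.
Qed.

(** [p a b v k] speaks of the rectangle with lower left corner [(a, b)], width [v] and height [k]. A
    property inherited by some quarter descends along a chain of quarters that shrinks to a point
    [(x, y)]. *)
Lemma rectangle_bisection (p : R -> R -> R -> R -> Prop) (a0 b0 w h : R) :
  0 < w -> 0 < h ->
  (forall a b v k, 0 < v -> 0 < k -> p a b v k ->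
    p a b (v / 2) (k / 2) \/ p (a + v / 2) b (v / 2) (k / 2) \/
    p a (b + k / 2) (v / 2) (k / 2) \/ p (a + v / 2) (b + k / 2) (v / 2) (k / 2)) ->
  p a0 b0 w h ->
  exists x y, forall n, exists a b,
    a <= x <= a + w / 2 ^ n /\ b <= y <= b + h / 2 ^ n /\
    a0 <= a /\ a + w / 2 ^ n <= a0 + w /\ b0 <= b /\ b + h / 2 ^ n <= b0 + h /\
    p a b (w / 2 ^ n) (h / 2 ^ n).
Proof.
intros Hw Hh Hp Hp0.
assert (Hpow : forall n : nat, 0 < 2 ^ n) by (intros n; apply pow_lt; lra).
(* Stated as an implication so that every pair has a successor, as dependent choice demands; the
   premise is discharged afterwards by induction in [HP]. *)
set (step := fun (n : nat) (c d : R * R) =>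
  p (fst c) (snd c) (w / 2 ^ n) (h / 2 ^ n) ->
  (d = c \/ d = (fst c + w / 2 ^ S n, snd c) \/
   d = (fst c, snd c + h / 2 ^ S n) \/ d = (fst c + w / 2 ^ S n, snd c + h / 2 ^ S n))
  /\ p (fst d) (snd d) (w / 2 ^ S n) (h / 2 ^ S n)).
destruct (dependent_choice step (a0, b0)) as (u & Hu0 & Hu).
{ intros n [a b].
  destruct (classic (p a b (w / 2 ^ n) (h / 2 ^ n))) as [H|H];
    [|exists (a, b); intros H'; contradiction].
  specialize (Hp a b _ _ (Rdiv_lt_0_compat _ _ Hw (Hpow n))
    (Rdiv_lt_0_compat _ _ Hh (Hpow n)) H).
  assert (E : forall v, v / 2 ^ n / 2 = v / 2 ^ S n).
  { intros v. simpl. field. apply Rgt_not_eq, Hpow. }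
  rewrite !E in Hp.
  destruct Hp as [H1 | [H1 | [H1 | H1]]].
  - exists (a, b). intros _. split; [now left | exact H1].
  - exists (a + w / 2 ^ S n, b). intros _. split; [right; now left | exact H1].
  - exists (a, b + h / 2 ^ S n). intros _.
    split; [right; right; now left | exact H1].
  - exists (a + w / 2 ^ S n, b + h / 2 ^ S n). intros _.
    split; [right; right; now right | exact H1]. }
assert (HP : forall n, p (fst (u n)) (snd (u n)) (w / 2 ^ n) (h / 2 ^ n)).
{ induction n as [|n IH].
  - rewrite Hu0. simpl. now rewrite !Rdiv_1_r.
  - apply (Hu n IH). }
assert (E : forall v n, v / 2 ^ n = v / 2 ^ S n + v / 2 ^ S n).
{ intros v n. simpl. field. apply Rgt_not_eq, Hpow. }
assert (Hs : forall v n, 0 < v -> 0 < v / 2 ^ n).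
{ intros v n Hv. now apply Rdiv_lt_0_compat. }
assert (St : forall n, fst (u n) <= fst (u (S n)) /\
  fst (u (S n)) + w / 2 ^ S n <= fst (u n) + w / 2 ^ n /\
  snd (u n) <= snd (u (S n)) /\
  snd (u (S n)) + h / 2 ^ S n <= snd (u n) + h / 2 ^ n).
{ intros n. rewrite (E w n), (E h n).
  pose proof (Hs w (S n) Hw). pose proof (Hs h (S n) Hh).
  destruct (proj1 (Hu n (HP n))) as [-> | [-> | [-> | ->]]]; cbn [fst snd];
    repeat split; lra. }
destruct (nested_intervals (fun n => fst (u n)) (fun n => fst (u n) + w / 2 ^ n))
  as [x Hx].
{ intros n. apply St. }
{ intros n. apply St. }
{ intros n. pose proof (Hs w n Hw). lra. }
destruct (nested_intervals (fun n => snd (u n)) (fun n => snd (u n) + h / 2 ^ n))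
  as [y Hy].
{ intros n. apply St. }
{ intros n. apply St. }
{ intros n. pose proof (Hs h n Hh). lra. }
exists x, y. intros n. exists (fst (u n)), (snd (u n)).
assert (In : a0 <= fst (u n) /\ fst (u n) + w / 2 ^ n <= a0 + w /\
  b0 <= snd (u n) /\ snd (u n) + h / 2 ^ n <= b0 + h).
{ induction n as [|n IH].
  - rewrite Hu0. simpl. rewrite !Rdiv_1_r. lra.
  - destruct (St n) as (? & ? & ? & ?). lra. }
repeat split; try apply Hx; try apply Hy; try apply In. apply HP.
Qed.

(** * Flux of differentiable plane fields through rectangles *)

Definition diff2 (P : R -> R -> R) (x y A B : R) : Prop :=
  forall eps, 0 < eps -> exists delta, 0 < delta /\
    forall u v, Rabs (u - x) < delta -> Rabs (v - y) < delta ->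
      Rabs (P u v - P x y - A * (u - x) - B * (v - y))
        <= eps * (Rabs (u - x) + Rabs (v - y)).

Lemma diff2_continuous_r (P : R -> R -> R) (x y A B : R) :
  diff2 P x y A B -> continuous (P x) y.
Proof.
intros H. apply continuity_pt_filterlim, derivable_continuous_pt.
exists B. intros eps Heps.
destruct (H (eps / 2)) as (d & Hd & Hv); [lra|].
exists (mkposreal d Hd). intros h Hh Hhd. simpl in Hhd.
specialize (Hv x (y + h)).
replace (y + h - y) with h in Hv by ring.
rewrite Rminus_diag, Rabs_R0, Rplus_0_l, Rmult_0_r, Rminus_0_r in Hv.
specialize (Hv Hd Hhd).
replace ((P x (y + h) - P x y) / h - B)
  with ((P x (y + h) - P x y - B * h) / h) by (field; exact Hh).
unfold Rdiv. rewrite Rabs_mult, Rabs_inv.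
pose proof (Rabs_pos_lt h Hh).
apply Rlt_div_l; [assumption|]. nra.
Qed.

Lemma diff2_swap (P : R -> R -> R) (x y A B : R) :
  diff2 P x y A B -> diff2 (fun v u => P u v) y x B A.
Proof.
intros H eps Heps. destruct (H eps Heps) as (d & Hd & Hv).
exists d; split; [exact Hd|]. intros v u Hv' Hu'.
rewrite (Rplus_comm (Rabs (v - y))).
replace (P u v - P x y - B * (v - y) - A * (u - x))
  with (P u v - P x y - A * (u - x) - B * (v - y)) by ring.
now apply Hv.
Qed.

(** The outward flux of the field [(P, Q)] through the boundary. For [P = Re H] and [Q = - Im H] it
    is the imaginary part of the contour integral of [H dz]. *)
Definition flux (P Q : R -> R -> R) (x1 x2 y1 y2 : R) : R :=
  RInt (P x2) y1 y2 - RInt (P x1) y1 y2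
  + (RInt (fun x => Q x y2) x1 x2 - RInt (fun x => Q x y1) x1 x2).

(** On each side of a small rectangle the field is replaced by its affine part, whose integral is
    explicit; with [m = 0] the same estimate serves for mean values. *)
Lemma RInt_affine_approx (f : R -> R) (a b e c m y0 : R) :
  a <= b -> ex_RInt f a b ->
  (forall y, a <= y <= b -> Rabs (f y - (c + m * (y - y0))) <= e) ->
  Rabs (RInt f a b - (c * (b - a) + m * ((b - y0) ^ 2 - (a - y0) ^ 2) / 2))
    <= e * (b - a).
Proof.
intros Hab Hf He.
assert (HI : is_RInt (fun y => c + m * (y - y0)) a b
  (c * (b - a) + m * ((b - y0) ^ 2 - (a - y0) ^ 2) / 2)).
{ replace (c * (b - a) + m * ((b - y0) ^ 2 - (a - y0) ^ 2) / 2)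
    with (minus (c * b + m * (b - y0) ^ 2 / 2) (c * a + m * (a - y0) ^ 2 / 2))
    by (unfold minus, plus, opp; simpl; field).
  apply (is_RInt_derive (fun y => c * y + m * (y - y0) ^ 2 / 2)).
  - intros y _. auto_derive; [exact I | field].
  - intros y _. apply (ex_derive_continuous (V := R_NormedModule)).
    auto_derive. exact I. }
rewrite <- (is_RInt_unique _ _ _ _ HI).
assert (HE : ex_RInt (fun y => c + m * (y - y0)) a b) by (eexists; exact HI).
replace (RInt f a b - RInt (fun y => c + m * (y - y0)) a b)
  with (RInt (fun y => f y - (c + m * (y - y0))) a b)
  by exact (RInt_minus (V := R_CompleteNormedModule) f _ a b Hf HE).
rewrite Rmult_comm. apply abs_RInt_le_const; [exact Hab| |exact He].
exact (ex_RInt_minus (V := R_NormedModule) f _ a b Hf HE).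
Qed.

(** The shared [A] encodes that the partial derivatives of [P] in [x] and of [Q] in [y] add up to
    0. *)
Definition divergence_free_on (P Q : R -> R -> R) (x1 x2 y1 y2 : R) : Prop :=
  forall x y, x1 <= x <= x2 -> y1 <= y <= y2 ->
    exists A B D, diff2 P x y A B /\ diff2 Q x y D (- A).

Lemma divergence_free_ex_RInt (P Q : R -> R -> R) (x1 x2 y1 y2 : R) :
  divergence_free_on P Q x1 x2 y1 y2 ->
  (forall x a b, x1 <= x <= x2 -> y1 <= a -> a <= b -> b <= y2 -> ex_RInt (P x) a b) /\
  (forall y a b, y1 <= y <= y2 -> x1 <= a -> a <= b -> b <= x2 ->
    ex_RInt (fun x => Q x y) a b).
Proof.
intros H. split.
- intros x a b Hx H1 H2 H3. apply (ex_RInt_continuous (V := R_CompleteNormedModule)).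
  intros y. rewrite Rmin_left, Rmax_right by exact H2. intros Hy.
  destruct (H x y Hx) as (A & B & D & HP & _); [lra|].
  exact (diff2_continuous_r _ _ _ _ _ HP).
- intros y a b Hy H1 H2 H3. apply (ex_RInt_continuous (V := R_CompleteNormedModule)).
  intros x. rewrite Rmin_left, Rmax_right by exact H2. intros Hx.
  destruct (H x y) as (A & B & D & _ & HQ); [lra | exact Hy |].
  exact (diff2_continuous_r _ _ _ _ _ (diff2_swap _ _ _ _ _ HQ)).
Qed.

(* Goursat's bisection argument, which needs no continuity of the partial
   derivatives. *)
Lemma flux_divergence_free (P Q : R -> R -> R) (x1 x2 y1 y2 : R) :
  x1 < x2 -> y1 < y2 -> divergence_free_on P Q x1 x2 y1 y2 ->
  flux P Q x1 x2 y1 y2 = 0.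
Proof.
intros Hx Hy HD.
destruct (divergence_free_ex_RInt _ _ _ _ _ _ HD) as [IP IQ].
destruct (Req_dec (flux P Q x1 x2 y1 y2) 0) as [E|E]; [exact E|exfalso].
set (w := x2 - x1). set (h := y2 - y1).
assert (Hw : 0 < w) by (unfold w; lra). assert (Hh : 0 < h) by (unfold h; lra).
(* Flux per unit area: since the fluxes of four quarters add up, some quarter keeps a flux of at
   least [k] times its area. *)
set (k := Rabs (flux P Q x1 x2 y1 y2) / (w * h)).
assert (Hk : 0 < k).
{ apply Rdiv_lt_0_compat; [now apply Rabs_pos_lt | nra]. }
destruct (rectangle_bisection (fun a b v l =>
  x1 <= a /\ a + v <= x2 /\ y1 <= b /\ b + l <= y2 /\
  k * (v * l) <= Rabs (flux P Q a (a + v) b (b + l))) x1 y1 w h Hw Hh)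
  as (x & y & HB).
{ intros a b v l Hv Hl (Ha1 & Ha2 & Hb1 & Hb2 & HF).
  set (F1 := flux P Q a (a + v / 2) b (b + l / 2)).
  set (F2 := flux P Q (a + v / 2) (a + v / 2 + v / 2) b (b + l / 2)).
  set (F3 := flux P Q a (a + v / 2) (b + l / 2) (b + l / 2 + l / 2)).
  set (F4 := flux P Q (a + v / 2) (a + v / 2 + v / 2) (b + l / 2) (b + l / 2 + l / 2)).
  assert (HS : flux P Q a (a + v) b (b + l) = F1 + F2 + F3 + F4).
  { unfold F1, F2, F3, F4, flux.
    replace (a + v / 2 + v / 2) with (a + v) by field.
    replace (b + l / 2 + l / 2) with (b + l) by field.
    rewrite <- (RInt_Chasles (V := R_CompleteNormedModule) (P (a + v)) b (b + l / 2) (b + l))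
      by (apply IP; lra).
    rewrite <- (RInt_Chasles (V := R_CompleteNormedModule) (P a) b (b + l / 2) (b + l))
      by (apply IP; lra).
    rewrite <- (RInt_Chasles (V := R_CompleteNormedModule)
      (fun x => Q x b) a (a + v / 2) (a + v)) by (apply IQ; lra).
    rewrite <- (RInt_Chasles (V := R_CompleteNormedModule)
      (fun x => Q x (b + l)) a (a + v / 2) (a + v)) by (apply IQ; lra).
    unfold plus; simpl. ring. }
  assert (HA : Rabs (F1 + F2 + F3 + F4) <= Rabs F1 + Rabs F2 + Rabs F3 + Rabs F4).
  { eapply Rle_trans; [apply Rabs_triang|]. apply Rplus_le_compat_r.
    eapply Rle_trans; [apply Rabs_triang|]. apply Rplus_le_compat_r.
    apply Rabs_triang. }
  rewrite HS in HF.
  destruct (Rle_dec (k * (v / 2 * (l / 2))) (Rabs F1)) as [G1|G1];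
    [left; repeat split; try lra; exact G1|].
  destruct (Rle_dec (k * (v / 2 * (l / 2))) (Rabs F2)) as [G2|G2];
    [right; left; repeat split; try lra; exact G2|].
  destruct (Rle_dec (k * (v / 2 * (l / 2))) (Rabs F3)) as [G3|G3];
    [right; right; left; repeat split; try lra; exact G3|].
  destruct (Rle_dec (k * (v / 2 * (l / 2))) (Rabs F4)) as [G4|G4];
    [right; right; right; repeat split; try lra; exact G4|].
  exfalso. apply Rnot_le_lt in G1, G2, G3, G4.
  assert (4 * (k * (v / 2 * (l / 2))) = k * (v * l)) by field. lra. }
{ unfold w, h in *. repeat split; try lra.
  replace (x1 + (x2 - x1)) with x2 by ring. replace (y1 + (y2 - y1)) with y2 by ring.
  unfold k. right. field. lra. }
assert (Hxy : x1 <= x <= x2 /\ y1 <= y <= y2).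
{ destruct (HB 0%nat) as (a & b & Ha & Hb & H1 & H2 & H3 & H4 & _).
  simpl in *. rewrite !Rdiv_1_r in *. unfold w, h in *. lra. }
destruct (HD x y) as (A & B & D & HP & HQ); try apply Hxy.
(* Bisection preserves the ratio of the sides, so on the [n]-th rectangle the lower bound [k w' h']
   equals [4 eps (w' + h')^2], twice what the affine approximation allows. *)
set (eps := k * (w * h) / (4 * (w + h) ^ 2)).
assert (Heps : 0 < eps).
{ apply Rdiv_lt_0_compat; [|apply Rmult_lt_0_compat; [lra | apply pow_lt; lra]].
  apply Rmult_lt_0_compat; [exact Hk | nra]. }
destruct (HP eps Heps) as (d1 & Hd1 & HPd).
destruct (HQ eps Heps) as (d2 & Hd2 & HQd).
assert (Hd : 0 < Rmin d1 d2) by now apply Rmin_pos.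
assert (HN : exists n : nat, (w + h) / 2 ^ n < Rmin d1 d2).
{ destruct (pow_lt_1_zero (/ 2)) with (y := Rmin d1 d2 / (w + h)) as [n Hn].
  - rewrite Rabs_right; lra.
  - apply Rdiv_lt_0_compat; lra.
  - exists n. specialize (Hn n (Nat.le_refl n)).
    rewrite Rabs_right in Hn by (apply Rle_ge, pow_le; lra).
    apply Rlt_div_r in Hn; [|lra].
    rewrite pow_inv in Hn. unfold Rdiv. lra. }
destruct HN as [n Hn].
destruct (HB n) as (a & b & Ha & Hb & H1 & H2 & H3 & H4 & H5 & H6 & H7 & H8 & HF).
assert (H2n : 0 < 2 ^ n) by (apply pow_lt; lra).
set (w' := w / 2 ^ n) in *. set (h' := h / 2 ^ n) in *.
assert (Hw' : 0 < w') by now apply Rdiv_lt_0_compat.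
assert (Hh' : 0 < h') by now apply Rdiv_lt_0_compat.
assert (Hwh : w' + h' < Rmin d1 d2) by (unfold w', h'; lra).
pose proof (Rmin_l d1 d2). pose proof (Rmin_r d1 d2).
assert (Ek : k * (w' * h') = 4 * eps * (w' + h') ^ 2).
{ unfold eps, w', h'. field. split; lra. }
assert (EP : forall u v, a <= u <= a + w' -> b <= v <= b + h' ->
  Rabs (P u v - (P x y + A * (u - x) + B * (v - y))) <= eps * (w' + h')).
{ intros u v Hu Hv.
  assert (U : Rabs (u - x) <= w') by (apply Rabs_le; lra).
  assert (V : Rabs (v - y) <= h') by (apply Rabs_le; lra).
  replace (P u v - (P x y + A * (u - x) + B * (v - y)))
    with (P u v - P x y - A * (u - x) - B * (v - y)) by ring.
  eapply Rle_trans; [apply HPd; lra|]. apply Rmult_le_compat_l; lra. }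
assert (EQ : forall u v, a <= u <= a + w' -> b <= v <= b + h' ->
  Rabs (Q u v - (Q x y + - A * (v - y) + D * (u - x))) <= eps * (w' + h')).
{ intros u v Hu Hv.
  assert (U : Rabs (u - x) <= w') by (apply Rabs_le; lra).
  assert (V : Rabs (v - y) <= h') by (apply Rabs_le; lra).
  replace (Q u v - (Q x y + - A * (v - y) + D * (u - x)))
    with (Q u v - Q x y - D * (u - x) - - A * (v - y)) by ring.
  eapply Rle_trans; [apply HQd; lra|]. apply Rmult_le_compat_l; lra. }
assert (T1 := RInt_affine_approx (P (a + w')) b (b + h') (eps * (w' + h'))
  (P x y + A * (a + w' - x)) B y ltac:(lra) ltac:(apply IP; lra)
  ltac:(intros v Hv; apply EP; lra)).
assert (T2 := RInt_affine_approx (P a) b (b + h') (eps * (w' + h'))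
  (P x y + A * (a - x)) B y ltac:(lra) ltac:(apply IP; lra)
  ltac:(intros v Hv; apply EP; lra)).
assert (T3 := RInt_affine_approx (fun u => Q u (b + h')) a (a + w') (eps * (w' + h'))
  (Q x y + - A * (b + h' - y)) D x ltac:(lra) ltac:(apply IQ; lra)
  ltac:(intros v Hv; apply EQ; lra)).
assert (T4 := RInt_affine_approx (fun u => Q u b) a (a + w') (eps * (w' + h'))
  (Q x y + - A * (b - y)) D x ltac:(lra) ltac:(apply IQ; lra)
  ltac:(intros v Hv; apply EQ; lra)).
unfold flux in HF.
apply Rabs_le_between in T1, T2, T3, T4.
(* The affine parts cancel: the vertical sides contribute [A w' h'], the horizontal ones
   [- A w' h'], and the [B] and [D] terms agree on opposite sides. What remains is the error
   [eps (w' + h')] times the perimeter. *)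
assert (HF2 : Rabs (RInt (P (a + w')) b (b + h') - RInt (P a) b (b + h')
  + (RInt (fun x => Q x (b + h')) a (a + w') - RInt (fun x => Q x b) a (a + w')))
  <= 2 * eps * (w' + h') ^ 2).
{ apply Rabs_le. nra. }
assert (0 < eps * (w' + h') ^ 2).
{ apply Rmult_lt_0_compat; [exact Heps | apply pow_lt; lra]. }
lra.
Qed.

(** * Mean values of periodic functions *)

(** The Cauchy-Riemann equations, arranged so that the field [(Re H, - Im H)] is divergence-free. *)
Lemma cdiff_diff2 (H : C -> C) (x y : R) (l : C) : cdiff H (x, y) l ->
  diff2 (fun u v => Re (H (u, v))) x y (Re l) (- Im l) /\
  diff2 (fun u v => - Im (H (u, v))) x y (- Im l) (- Re l).
Proof.
intros Hd.
assert (K : forall eps, 0 < eps -> exists delta, 0 < delta /\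
  forall u v, Rabs (u - x) < delta -> Rabs (v - y) < delta ->
    Cmod (H (u, v) - H (x, y) - l * ((u, v) - (x, y)))
      <= eps * (Rabs (u - x) + Rabs (v - y))).
{ intros eps Heps. destruct (Hd eps Heps) as (d & Hd0 & Hw).
  exists (d / 2). split; [lra|]. intros u v Hu Hv.
  pose proof (Cmod_le_abs ((u, v) - (x, y))) as Hc. simpl in Hc.
  eapply Rle_trans; [apply Hw; unfold Rminus in *; lra|].
  apply Rmult_le_compat_l; [lra | exact Hc]. }
split; intros eps Heps; destruct (K eps Heps) as (d & Hd0 & Hw);
  exists d; (split; [exact Hd0|]); intros u v Hu Hv;
  (eapply Rle_trans; [|exact (Hw u v Hu Hv)]).
- eapply Rle_trans; [|apply re_le_Cmod]. right. f_equal.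
  unfold Re, Im; simpl; ring.
- rewrite <- Rabs_Ropp. eapply Rle_trans; [|apply im_Cmod]. right. f_equal.
  unfold Re, Im; simpl; ring.
Qed.

(** Periodic functions on [Re w < 0] stand for functions of [v = exp w] on the punctured unit disc;
    the vertical segment at abscissa [x] is the circle [|v| = exp x]. *)
Definition periodic_2PI (H : C -> C) : Prop :=
  forall x y, H (x, y + 2 * PI) = H (x, y).

Definition cdiff_left (H : C -> C) : Prop :=
  forall w : C, Re w < 0 -> exists l, cdiff H w l.

Lemma ex_RInt_vertical (H : C -> C) (x : R) : cdiff_left H -> x < 0 ->
  ex_RInt (fun y => Re (H (x, y))) 0 (2 * PI).
Proof.
intros Hd Hx. apply (ex_RInt_continuous (V := R_CompleteNormedModule)).
intros y _. destruct (Hd (x, y) Hx) as [l Hl].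
exact (diff2_continuous_r _ _ _ _ _ (proj1 (cdiff_diff2 _ _ _ _ Hl))).
Qed.

(** On a rectangle of height [2 * PI] the two horizontal sides cancel by periodicity, so the
    vanishing flux compares the vertical sides alone. *)
Lemma vertical_mean_lt (H : C -> C) (x1 x2 : R) :
  cdiff_left H -> periodic_2PI H -> x1 < x2 -> x2 < 0 ->
  RInt (fun y => Re (H (x1, y))) 0 (2 * PI) = RInt (fun y => Re (H (x2, y))) 0 (2 * PI).
Proof.
intros Hd Hp H12 H2. pose proof PI_RGT_0 as Hpi.
assert (HF : flux (fun u v => Re (H (u, v))) (fun u v => - Im (H (u, v)))
  x1 x2 0 (2 * PI) = 0).
{ apply flux_divergence_free; [exact H12 | lra|].
  intros x y Hx Hy. destruct (Hd (x, y)) as [l Hl]; [simpl; lra|].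
  exists (Re l), (- Im l), (- Im l). exact (cdiff_diff2 _ _ _ _ Hl). }
unfold flux in HF.
rewrite (RInt_ext (fun x => - Im (H (x, 2 * PI))) (fun x => - Im (H (x, 0)))) in HF.
- lra.
- intros x _. rewrite <- (Hp x 0). now rewrite Rplus_0_l.
Qed.

Lemma vertical_mean (H : C -> C) (x1 x2 : R) :
  cdiff_left H -> periodic_2PI H -> x1 < 0 -> x2 < 0 ->
  RInt (fun y => Re (H (x1, y))) 0 (2 * PI) = RInt (fun y => Re (H (x2, y))) 0 (2 * PI).
Proof.
intros Hd Hp H1 H2. destruct (Rtotal_order x1 x2) as [Hx | [-> | Hx]].
- now apply vertical_mean_lt.
- reflexivity.
- symmetry. now apply vertical_mean_lt.
Qed.

Lemma RInt_near_const (f : R -> R) (c e : R) : ex_RInt f 0 (2 * PI) ->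
  (forall y, Rabs (f y - c) <= e) ->
  Rabs (RInt f 0 (2 * PI) - 2 * PI * c) <= 2 * PI * e.
Proof.
intros Hf He. pose proof PI_RGT_0 as Hpi.
pose proof (RInt_affine_approx f 0 (2 * PI) e c 0 0 ltac:(lra) Hf) as H.
replace (c * (2 * PI - 0) + 0 * ((2 * PI - 0) ^ 2 - (0 - 0) ^ 2) / 2)
  with (2 * PI * c) in H by field.
rewrite (Rmult_comm _ e). rewrite Rminus_0_r in H. apply H.
intros y _. replace (c + 0 * (y - 0)) with c by ring. apply He.
Qed.

(* The mean value property at the centre of a disc, read in the logarithmic
   coordinate, where the centre sits at [Re w = -infinity]. *)
Lemma periodic_limit_zero (H : C -> C) (L : C) :
  cdiff_left H -> periodic_2PI H ->
  (forall eps, 0 < eps -> exists x, x < 0 /\ forall y, Cmod (H (x, y)) <= eps) ->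
  (forall eps, 0 < eps -> exists x, x < 0 /\ forall y, Cmod (H (x, y) - L) <= eps) ->
  L = 0.
Proof.
intros Hd Hp H0 HL. apply Cmod_eq_0.
assert (Key : forall eps, 0 < eps -> Cmod L ^ 2 <= eps).
(* The mean value statement concerns real parts; multiplying by the conjugate of [L] makes the limit
   the real number [|L|^2]. *)
{ intros eps Heps. set (c := Cconj L).
  pose proof (Cmod_ge_0 L) as HLp.
  set (e := eps / (2 * (Cmod L + 1))).
  assert (He : 0 < e) by (apply Rdiv_lt_0_compat; lra).
  assert (Hd' : cdiff_left (fun w => c * H w)%C).
  { intros w Hw. destruct (Hd w Hw) as [l Hl]. exists (c * l)%C. now apply cdiff_scal. }
  assert (Hp' : periodic_2PI (fun w => c * H w)%C).
  { intros x y. now rewrite Hp. }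
  assert (Hc : Cmod c = Cmod L) by apply Cmod_conj.
  assert (Hce : Cmod L * e <= eps / 2).
  { apply Rle_trans with ((Cmod L + 1) * e); [apply Rmult_le_compat_r; lra|].
    unfold e. right. field. lra. }
  assert (HcL : Re (c * L)%C = Cmod L ^ 2).
  { unfold c. rewrite Cmod2_alt. destruct L as [a b]. simpl. ring. }
  destruct (H0 e He) as (x1 & Hx1 & B1). destruct (HL e He) as (x2 & Hx2 & B2).
  pose proof (RInt_near_const _ 0 (eps / 2) (ex_RInt_vertical _ x1 Hd' Hx1)) as T1.
  pose proof (RInt_near_const _ (Cmod L ^ 2) (eps / 2) (ex_RInt_vertical _ x2 Hd' Hx2)) as T2.
  cbv beta in T1, T2.
  rewrite (vertical_mean _ x1 x2 Hd' Hp' Hx1 Hx2) in T1.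
  pose proof PI_RGT_0 as Hpi.
  assert (T1' := T1 ltac:(
    intros y; rewrite Rminus_0_r; eapply Rle_trans; [apply re_le_Cmod|];
    rewrite Cmod_mult, Hc; eapply Rle_trans; [|exact Hce];
    apply Rmult_le_compat_l; [exact HLp | apply B1])).
  assert (T2' := T2 ltac:(
    intros y; rewrite <- HcL;
    replace (Re (c * H (x2, y))%C - Re (c * L)%C) with (Re (c * (H (x2, y) - L))%C)
      by (unfold Re, Cmult, Cminus, Cplus, Copp; simpl; ring);
    eapply Rle_trans; [apply re_le_Cmod|];
    rewrite Cmod_mult, Hc; eapply Rle_trans; [|exact Hce];
    apply Rmult_le_compat_l; [exact HLp | apply B2])).
  apply Rabs_le_between in T1', T2'.
  apply (Rmult_le_reg_l (2 * PI)); nra. }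
pose proof (Cmod_ge_0 L).
destruct (Req_dec (Cmod L) 0) as [E|E]; [exact E|exfalso].
assert (HH : 0 < Cmod L ^ 2 / 2) by (pose proof (pow_lt (Cmod L) 2 ltac:(lra)); lra).
specialize (Key _ HH). lra.
Qed.

(** * Products of rotates *)

Fixpoint shift_prod (g : C -> C) (d : R) (n : nat) (w : C) : C :=
  match n with
  | O => 1
  | S n => Cmult (shift_prod g d n w) (g (Cplus w (0, INR n * d)))
  end.

Lemma shift_prod_cdiff (g : C -> C) (d : R) (n : nat) :
  cdiff_left g -> cdiff_left (shift_prod g d n).
Proof.
intros Hg. induction n as [|n IH]; intros w Hw.
- exists 0. apply cdiff_const.
- destruct (IH w Hw) as [l Hl].
  destruct (Hg (Cplus w (0, INR n * d))) as [m Hm]; [destruct w; simpl in *; lra|].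
  eexists. exact (cdiff_mult _ _ _ _ _ Hl (cdiff_comp _ _ _ _ _
    (cdiff_plus _ _ _ _ _ (cdiff_id w) (cdiff_const (0, INR n * d) w)) Hm)).
Qed.

Lemma shift_prod_periodic (g : C -> C) (d : R) (n : nat) :
  periodic_2PI g -> periodic_2PI (shift_prod g d n).
Proof.
intros Hg x y. induction n as [|n IH]; [reflexivity|].
simpl. rewrite IH. f_equal. unfold Cplus; simpl.
rewrite <- (Hg (x + 0) (y + INR n * d)). do 2 f_equal. ring.
Qed.

Lemma shift_prod_bound (g : C -> C) (d : R) (n : nat) (M x y : R) :
  1 <= M -> (forall y, Cmod (g (x, y)) <= M) ->
  Cmod (shift_prod g d n (x, y)) <= M ^ n.
Proof.
intros HM Hg. induction n as [|n IH].
- simpl. rewrite Cmod_1. lra.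
- simpl. rewrite Cmod_mult, Rmult_comm. unfold Cplus; simpl. rewrite Rplus_0_r.
  apply Rmult_le_compat; try apply Cmod_ge_0; [apply Hg | exact IH].
Qed.

(** One small factor makes the product small, the others being at most [M]. Because [1 <= M], the
    power [M ^ n] also covers the [n - 1] remaining factors. *)
Lemma shift_prod_small (g : C -> C) (d : R) (n : nat) (M e x y : R) (k : nat) :
  1 <= M -> (forall y, Cmod (g (x, y)) <= M) -> 0 <= e ->
  (k < n)%nat -> Cmod (g (x, y + INR k * d)) <= e ->
  Cmod (shift_prod g d n (x, y)) <= M ^ n * e.
Proof.
intros HM Hg He Hk Hge. induction n as [|n IH]; [lia|].
simpl. rewrite Cmod_mult. unfold Cplus; simpl. rewrite Rplus_0_r.
assert (0 <= M ^ n) by (apply pow_le; lra).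
destruct (Nat.eq_dec k n) as [-> | Hn].
- pose proof (shift_prod_bound g d n M x y HM Hg).
  apply Rle_trans with (M ^ n * e).
  + apply Rmult_le_compat; try apply Cmod_ge_0; assumption.
  + apply Rmult_le_compat_r; [exact He|]. nra.
- rewrite (Rmult_comm M), Rmult_assoc, (Rmult_comm M), <- Rmult_assoc.
  apply Rmult_le_compat; try apply Cmod_ge_0; [apply IH; lia | apply Hg].
Qed.

(** All translates share the limit [L] because the hypothesis is uniform in [y]. *)
Lemma shift_prod_limit (g : C -> C) (L : C) (d : R) (n : nat) :
  (forall eps, 0 < eps -> exists x0, forall x y, x < x0 -> Cmod (g (x, y) - L) <= eps) ->
  forall eps, 0 < eps -> exists x0, forall x y, x < x0 ->
    Cmod (shift_prod g d n (x, y) - L ^ n) <= eps.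
Proof.
intros Hg. induction n as [|n IH]; intros eps Heps.
- exists 0. intros x y _. simpl. replace (1 - 1)%C with (RtoC 0) by ring.
  rewrite Cmod_0. lra.
- pose proof (Cmod_ge_0 L) as HL. pose proof (Cmod_ge_0 (L ^ n)%C) as HLn.
  destruct (IH (Rmin 1 (eps / (2 * (Cmod L + 1))))) as [x1 H1].
  { apply Rmin_pos; [lra|]. apply Rdiv_lt_0_compat; lra. }
  destruct (Hg (eps / (2 * (Cmod (L ^ n)%C + 1)))) as [x2 H2].
  { apply Rdiv_lt_0_compat; lra. }
  exists (Rmin x1 x2). intros x y Hx. simpl.
  assert (E1 := H1 x y (Rlt_le_trans _ _ _ Hx (Rmin_l _ _))).
  assert (E2 := H2 x (y + INR n * d) (Rlt_le_trans _ _ _ Hx (Rmin_r _ _))).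
  pose proof (Rmin_l 1 (eps / (2 * (Cmod L + 1)))).
  pose proof (Rmin_r 1 (eps / (2 * (Cmod L + 1)))).
  unfold Cplus at 1; simpl. rewrite Rplus_0_r.
  set (S := shift_prod g d n (x, y)) in *. set (G := g (x, y + INR n * d)) in *.
  replace (S * G - L * L ^ n)%C with (S * (G - L) + L * (S - L ^ n))%C by ring.
  eapply Rle_trans; [apply Cmod_triangle|]. rewrite !Cmod_mult.
  pose proof (Cmod_triangle_sub S (L ^ n)%C).
  assert (A1 : Cmod S * Cmod (G - L) <= eps / 2).
  { apply Rle_trans with ((Cmod (L ^ n)%C + 1) * (eps / (2 * (Cmod (L ^ n)%C + 1)))).
    - apply Rmult_le_compat; try apply Cmod_ge_0; lra.
    - right. field. lra. }
  assert (A2 : Cmod L * Cmod (S - L ^ n)%C <= eps / 2).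
  { apply Rle_trans with ((Cmod L + 1) * (eps / (2 * (Cmod L + 1)))).
    - apply Rmult_le_compat; try apply Cmod_ge_0; lra.
    - right. field. lra. }
  lra.
Qed.

(** * Uniqueness from zero boundary values on an interval *)

(** The Cayley map from the unit disc onto the right half-plane, with centre 0 sent to 1. *)
Definition cayley (v : C) : C := ((1 + v) * / (1 + - (1) * v))%C.

Lemma cayley_den_neq_0 (v : C) : Re v < 1 -> (1 + - (1) * v <> 0)%C.
Proof.
intros H E. apply (f_equal Re) in E. unfold Re in *; simpl in *. lra.
Qed.

Lemma cdiff_cayley (v : C) : Re v < 1 -> exists l, cdiff cayley v l.
Proof.
intros H. eexists. apply cdiff_mult.
- apply cdiff_plus; [apply cdiff_const | apply cdiff_id].
- apply (cdiff_comp (fun v => 1 + - (1) * v)%C (fun w => / w)%C).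
  + apply cdiff_plus; [apply cdiff_const | apply cdiff_scal, cdiff_id].
  + apply cdiff_inv, cayley_den_neq_0, H.
Qed.

Lemma cayley_parts (v : C) : Re v < 1 ->
  Re (cayley v) = (1 - Cmod v ^ 2) / Cmod (1 - v) ^ 2 /\
  Im (cayley v) = 2 * Im v / Cmod (1 - v) ^ 2.
Proof.
intros H. rewrite !Cmod2_alt. destruct v as [a b]. unfold Re, Im in *; simpl in *.
assert (0 < (1 - a) * (1 - a) + b * b) by nra.
split; field; repeat split; nra.
Qed.

Lemma Re_Cexp_lt_1 (w : C) : Re w < 0 -> Re (Cexp w) < 1.
Proof.
intros H. eapply Rle_lt_trans; [apply Rle_abs|].
eapply Rle_lt_trans; [apply re_le_Cmod|]. rewrite Cmod_Cexp, <- exp_0.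
now apply exp_increasing.
Qed.

Lemma Cexp_periodic (x y : R) : Cexp (x, y + 2 * PI) = Cexp (x, y).
Proof.
unfold Cexp; simpl.
now rewrite cos_plus, sin_plus, cos_2PI, sin_2PI, !Rmult_1_r, !Rmult_0_r, Rminus_0_r,
  Rplus_0_r.
Qed.

Lemma periodic_2PI_Z (H : C -> C) (k : Z) (x y : R) : periodic_2PI H ->
  H (x, y + IZR k * (2 * PI)) = H (x, y).
Proof.
intros Hp.
assert (N : forall (n : nat) y, H (x, y + INR n * (2 * PI)) = H (x, y)).
{ induction n as [|n IH]; intros y'.
  - simpl. now rewrite Rmult_0_l, Rplus_0_r.
  - rewrite S_INR, <- (IH y'), <- (Hp x (y' + INR n * (2 * PI))). do 2 f_equal. ring. }
destruct (Z_le_gt_dec 0 k) as [Hk|Hk].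
- rewrite <- (Z2Nat.id k Hk), <- INR_IZR_INZ. apply N.
- rewrite <- (N (Z.to_nat (- k))). f_equal. f_equal.
  rewrite INR_IZR_INZ, Z2Nat.id, opp_IZR by lia. ring.
Qed.

(** Round [(t - y) / d] up to an integer [j] and divide [j] by [n]: the remainder is the rotation
    [k], the quotient the number [q] of full turns. *)
Lemma grid_near (n : nat) (y t : R) : (0 < n)%nat ->
  exists (k : nat) (q : Z), (k < n)%nat /\
    Rabs (y + INR k * (2 * PI / INR n) + IZR q * (2 * PI) - t) <= 2 * PI / INR n.
Proof.
intros Hn. pose proof PI_RGT_0 as Hpi.
assert (HN : 0 < INR n) by (now apply lt_0_INR).
set (d := 2 * PI / INR n).
assert (Hd : 0 < d) by (apply Rdiv_lt_0_compat; lra).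
set (j := up ((t - y) / d)).
destruct (archimed ((t - y) / d)) as [A1 A2]. fold j in A1, A2.
pose proof (Z.mod_pos_bound j (Z.of_nat n) ltac:(lia)) as Hm.
exists (Z.to_nat (j mod Z.of_nat n)), (j / Z.of_nat n)%Z. split; [lia|].
rewrite INR_IZR_INZ, Z2Nat.id by lia.
replace (y + IZR (j mod Z.of_nat n) * d + IZR (j / Z.of_nat n) * (2 * PI) - t)
  with (y + IZR j * d - t).
- apply Rlt_div_l in A1; [|exact Hd].
  assert (A3 : IZR j * d <= (t - y) + d).
  { replace (t - y + d) with (((t - y) / d + 1) * d) by (field; lra).
    apply Rmult_le_compat_r; lra. }
  apply Rabs_le. lra.
- pose proof (Z.div_mod j (Z.of_nat n) ltac:(lia)) as E.
  rewrite E at 1. rewrite plus_IZR, mult_IZR, <- INR_IZR_INZ.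
  unfold d. field. lra.
Qed.

Section BoundaryUniqueness.

Variables (F : C -> C) (a b K M : R).
Hypothesis HF : forall z : C, 0 < Re z -> exists l, cdiff F z l.
Hypothesis HM : forall z : C, 0 < Re z -> Cmod (F z) <= M.
Hypothesis Hab : a < b.
Hypothesis HK : forall z : C, 0 < Re z -> a < Im z < b -> Cmod (F z) <= K * Re z.
Variable p : C.
Hypothesis Hp : 0 < Re p.

(** [exp w] runs through the disc and the Cayley map is rescaled to send the centre to [p]. Thus
    [Re w] tending to minus infinity means approaching [p], and [Re w] tending to 0 means
    approaching the boundary. *)
Definition disc_chart (w : C) : C := (Re p * cayley (Cexp w) + (0, Im p)%R)%C.

Lemma disc_chart_cdiff (w : C) : Re (Cexp w) < 1 -> exists l, cdiff disc_chart w l.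
Proof.
intros H. destruct (cdiff_cayley _ H) as [l Hl]. eexists.
apply cdiff_plus; [|apply cdiff_const].
apply cdiff_scal. exact (cdiff_comp _ _ _ _ _ (cdiff_Cexp w) Hl).
Qed.

Lemma disc_chart_Re (w : C) : Re w < 0 ->
  Re (disc_chart w) = Re p * ((1 - exp (Re w) ^ 2) / Cmod (1 - Cexp w) ^ 2).
Proof.
intros H. pose proof (cayley_parts _ (Re_Cexp_lt_1 w H)) as [E _].
rewrite Cmod_Cexp in E. rewrite <- E. unfold disc_chart, Re; simpl. ring.
Qed.

Lemma disc_chart_den (w : C) : Re w < 0 -> 0 < Cmod (1 - Cexp w).
Proof.
intros H. apply Cmod_gt_0. intros E. apply (cayley_den_neq_0 _ (Re_Cexp_lt_1 w H)).
rewrite <- E. ring.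
Qed.

Lemma disc_chart_pos (w : C) : Re w < 0 -> 0 < Re (disc_chart w).
Proof.
intros H. rewrite disc_chart_Re by exact H.
pose proof (disc_chart_den w H) as Hd.
apply Rmult_lt_0_compat; [exact Hp|]. apply Rdiv_lt_0_compat; [|now apply pow_lt].
assert (exp (Re w) < 1) by (rewrite <- exp_0; now apply exp_increasing).
pose proof (exp_pos (Re w)). nra.
Qed.

(** Near the preimage [(0, t)] of the boundary point of height [(a + b) / 2] the chart stays in the
    strip, and its real part is at most a constant times [- x], so [HK] applies. *)
Lemma disc_chart_arc : exists t d B, 0 < d /\ 0 < B /\
  forall x y, - d < x < 0 -> Rabs (y - t) < d ->
    Cmod (F (disc_chart (x, y))) <= B * - x.
Proof.
(* On the circle the Cayley map sends [exp (i t)] to [i cot (t / 2)]. The target is [i s], whence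
   [t = PI - 2 * atan s]. *)
set (m := (a + b) / 2). set (s := (m - Im p) / Re p).
set (al := atan s). set (t := PI - 2 * al).
destruct (atan_bound s) as [Hal1 Hal2]. fold al in Hal1, Hal2.
assert (Hc : 0 < cos al) by (apply cos_gt_0; lra).
assert (Hs : sin al = s * cos al).
{ unfold s. fold s. rewrite <- (tan_atan s) at 1. fold al. unfold tan. field. lra. }
assert (Hsc : sin al * sin al + cos al * cos al = 1).
{ pose proof (sin2_cos2 al) as E. exact E. }
set (w0 := (0, t) : C).
assert (E0 : Cexp w0 = (1 - 2 * (cos al * cos al), 2 * sin al * cos al)).
{ unfold Cexp, w0; simpl. rewrite exp_0. unfold t.
  rewrite cos_minus, sin_minus, cos_PI, sin_PI, cos_2a, sin_2a.
  f_equal; nra. }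
assert (H1 : Re (Cexp w0) < 1) by (rewrite E0; simpl; nra).
assert (Him : Im (disc_chart w0) = m).
{ destruct (cayley_parts _ H1) as [_ E].
  assert (E1 : Im (cayley (Cexp w0)) = s).
  { rewrite E, Cmod2_alt, E0. unfold Re, Im; simpl.
    rewrite Hs in Hsc |- *. set (q := cos al) in *.
    match goal with |- _ / ?D = _ => replace D with (4 * (q * q)) end.
    - field. lra.
    - replace (4 * (q * q)) with (4 * (q * q) * (s * q * (s * q) + q * q))
        by (rewrite Hsc; ring).
      ring. }
  transitivity (Re p * Im (cayley (Cexp w0)) + Im p).
  - unfold disc_chart. generalize (cayley (Cexp w0)). intros q. unfold Im; simpl. ring.
  - rewrite E1. unfold s. field. lra. }
destruct (disc_chart_cdiff w0 H1) as [l Hl].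
destruct (cdiff_ccont _ _ _ Hl ((b - a) / 2)) as (d1 & Hd1 & C1); [lra|].
set (c := Cmod (1 - Cexp w0)).
assert (Hc0 : 0 < c).
{ apply Cmod_gt_0. intros E. apply (cayley_den_neq_0 _ H1). rewrite <- E. ring. }
destruct (cdiff_ccont _ _ _ (cdiff_Cexp w0) (c / 2)) as (d2 & Hd2 & C2); [lra|].
(* The real part is [Re p (1 - exp (2x)) / |1 - exp w|^2], with numerator factor at most [- 2 x] and
   denominator at least [(c / 2)^2]; this gives the 8. The sign of [K] is unknown, and the added 1
   makes [B] positive. *)
set (B := Rabs K * (Re p * (8 / c ^ 2)) + 1).
assert (HB : 0 <= Rabs K * (Re p * (8 / c ^ 2))).
{ apply Rmult_le_pos; [apply Rabs_pos|]. apply Rmult_le_pos; [lra|].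
  apply Rlt_le, Rdiv_lt_0_compat; [lra | now apply pow_lt]. }
exists t, (Rmin d1 d2 / 2), B.
assert (Hd : 0 < Rmin d1 d2) by now apply Rmin_pos.
split; [lra|]. split; [unfold B; lra|]. intros x y Hx Hy.
assert (Hw : Cmod ((x, y) - w0) < Rmin d1 d2).
{ eapply Rle_lt_trans; [apply Cmod_le_abs|]. unfold w0; simpl.
  rewrite Ropp_0, Rplus_0_r, (Rabs_left x) by lra. unfold Rminus in Hy. lra. }
specialize (C1 _ (Rlt_le_trans _ _ _ Hw (Rmin_l _ _))).
specialize (C2 _ (Rlt_le_trans _ _ _ Hw (Rmin_r _ _))).
assert (Hx0 : Re ((x, y) : C) < 0) by (simpl; lra).
pose proof (disc_chart_pos _ Hx0) as HRe.
assert (HIm : a < Im (disc_chart (x, y)) < b).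
{ pose proof (im_Cmod (disc_chart (x, y) - disc_chart w0)) as Hi.
  change (Im (disc_chart (x, y) - disc_chart w0))
    with (Im (disc_chart (x, y)) - Im (disc_chart w0)) in Hi.
  rewrite Him in Hi. apply Rabs_le_between in Hi. unfold m in Hi. lra. }
eapply Rle_trans; [apply (HK _ HRe HIm)|].
assert (Hden : c / 2 <= Cmod (1 - Cexp (x, y))).
{ pose proof (Cmod_triangle_sub (1 - Cexp w0) (1 - Cexp (x, y))) as T.
  replace (1 - Cexp w0 - (1 - Cexp (x, y)))%C with (Cexp (x, y) - Cexp w0)%C in T by ring.
  fold c in T. lra. }
assert (HR : Re (disc_chart (x, y)) <= Re p * (8 / c ^ 2) * - x).
{ rewrite disc_chart_Re by exact Hx0. rewrite Rmult_assoc.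
  apply Rmult_le_compat_l; [lra|].
  set (q := Cmod (1 - Cexp (x, y))) in *.
  assert (Hq : 0 < q ^ 2) by (apply pow_lt; lra).
  apply Rle_div_l; [exact Hq|].
  apply Rle_trans with (- 2 * x).
  - change (Re ((x, y) : C)) with x. simpl. rewrite Rmult_1_r, <- exp_plus.
    destruct (Req_dec (x + x) 0); [lra|].
    pose proof (exp_ineq1 (x + x) ltac:(assumption)). lra.
  - replace (8 / c ^ 2 * - x * q ^ 2) with (8 * - x * (q ^ 2 / c ^ 2)) by (field; lra).
    assert (/ 4 <= q ^ 2 / c ^ 2).
    { apply Rle_div_r; [now apply pow_lt|]. nra. }
    nra. }
apply Rle_trans with (Rabs K * Re (disc_chart (x, y))).
- apply Rmult_le_compat_r; [lra | apply Rle_abs].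
- apply Rle_trans with (Rabs K * (Re p * (8 / c ^ 2) * - x)).
  + apply Rmult_le_compat_l; [apply Rabs_pos | exact HR].
  + unfold B. nra.
Qed.

Lemma disc_chart_centre : forall eps, 0 < eps ->
  exists x0, forall x y, x < x0 -> Cmod (F (disc_chart (x, y)) - F p) <= eps.
Proof.
intros eps Heps. destruct (HF p Hp) as [l Hl].
destruct (cdiff_ccont _ _ _ Hl eps Heps) as (d & Hd & C1).
destruct (cdiff_cayley 0) as [l' Hl']; [simpl; lra|].
destruct (cdiff_ccont _ _ _ Hl' (d / Re p)) as (e & He & C2).
{ now apply Rdiv_lt_0_compat. }
exists (ln e). intros x y Hx. apply Rlt_le, C1.
assert (Hv : Cmod (Cexp (x, y) - 0) < e).
{ replace (Cexp (x, y) - 0)%C with (Cexp (x, y)) by ring.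
  rewrite Cmod_Cexp. simpl. rewrite <- (exp_ln e He). now apply exp_increasing. }
specialize (C2 _ Hv).
replace (disc_chart (x, y) - p)%C with (Re p * (cayley (Cexp (x, y)) - cayley 0))%C.
- rewrite Cmod_mult, Cmod_R, Rabs_right by lra.
  apply (Rmult_lt_compat_l (Re p)) in C2; [|exact Hp].
  now replace (Re p * (d / Re p)) with d in C2 by (field; lra).
- assert (E : cayley 0 = 1).
  { unfold cayley. replace (1 + - (1) * 0)%C with (RtoC 1) by ring. field. }
  rewrite E. unfold disc_chart.
  set (q := cayley (Cexp (x, y))). clearbody q.
  apply injective_projections; unfold Re, Im; simpl; ring.
Qed.

(* Moebius-transport the half-plane to the disc with centre [p], then multiply
   the rotates of [F] so that the arc carrying the boundary zeros is spread over
   the whole circle. *)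
Lemma boundary_zero_at : F p = 0.
Proof.
set (g := fun w => F (disc_chart w)).
assert (Hg : cdiff_left g).
{ intros w Hw. destruct (disc_chart_cdiff w (Re_Cexp_lt_1 w Hw)) as [l Hl].
  destruct (HF _ (disc_chart_pos w Hw)) as [l' Hl']. exists (l' * l)%C.
  exact (cdiff_comp _ _ _ _ _ Hl Hl'). }
assert (Hper : periodic_2PI g).
{ intros x y. unfold g, disc_chart. now rewrite Cexp_periodic. }
destruct disc_chart_arc as (t & d & B & Hd & HB & Harc).
pose proof PI_RGT_0 as Hpi.
(* With [2 * PI / n < d], at every height at least one of the [n] rotates lies in the arc. *)
destruct (INR_unbounded (2 * PI / d)) as [n Hn].
assert (HN : 0 < INR n).
{ assert (0 < 2 * PI / d) by (apply Rdiv_lt_0_compat; lra). lra. }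
assert (Hn0 : (0 < n)%nat) by (apply INR_lt; exact HN).
assert (Hdn : 2 * PI / INR n < d).
{ apply Rlt_div_l; [exact HN|]. apply Rlt_div_l in Hn; lra. }
(* The product of the rotates tends to [F p ^ n] at the centre and is uniformly small near the
   circle. *)
assert (HL : (F p ^ n)%C = 0).
{ apply (periodic_limit_zero (shift_prod g (2 * PI / INR n) n)).
  - now apply shift_prod_cdiff.
  - now apply shift_prod_periodic.
  - intros eps Heps. set (M' := Rmax 1 M).
    assert (HM' : 1 <= M') by apply Rmax_l.
    assert (HP : 0 < M' ^ n) by (apply pow_lt; lra).
    (* At abscissa [- e] the factor in the arc is at most [B * e] and the others at most [M']; the
       first bound keeps [- e] inside the range of the arc estimate. *)
    set (e := Rmin (d / 2) (eps / (M' ^ n * B))).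
    assert (He : 0 < e).
    { apply Rmin_pos; [lra|]. apply Rdiv_lt_0_compat; [exact Heps | nra]. }
    pose proof (Rmin_l (d / 2) (eps / (M' ^ n * B))) as He1. fold e in He1.
    pose proof (Rmin_r (d / 2) (eps / (M' ^ n * B))) as He2. fold e in He2.
    exists (- e). split; [lra|]. intros y.
    destruct (grid_near n y t Hn0) as (k & q & Hk & Hkq).
    apply Rle_trans with (M' ^ n * (B * e)).
    + apply (shift_prod_small _ _ _ _ _ _ _ k HM'); [|nra|exact Hk|].
      * intros y'. unfold g. eapply Rle_trans; [|apply Rmax_r].
        apply HM, disc_chart_pos. simpl. lra.
      * rewrite <- (periodic_2PI_Z g q) by exact Hper.
        rewrite <- (Ropp_involutive e) at 2. apply Harc; lra.
    + apply Rle_trans with (M' ^ n * B * (eps / (M' ^ n * B))).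
      * rewrite <- Rmult_assoc. apply Rmult_le_compat_l; [nra | exact He2].
      * right. field. split; lra.
  - intros eps Heps.
    destruct (shift_prod_limit g (F p) (2 * PI / INR n) n disc_chart_centre eps Heps)
      as [x0 Hx0].
    exists (Rmin x0 0 - 1). pose proof (Rmin_l x0 0). pose proof (Rmin_r x0 0).
    split; [lra|]. intros y. apply Hx0. lra. }
apply Cmod_eq_0. apply (f_equal Cmod) in HL. rewrite Cmod_pow, Cmod_0 in HL.
destruct (Req_dec (Cmod (F p)) 0) as [E|E]; [exact E|].
now apply (pow_nonzero _ n) in E.
Qed.

End BoundaryUniqueness.

(** * The function [(1 - w)^i] and its binomial series *)

Lemma derivable_segment (E : C -> C) (w l : C) (t : R) : cdiff E (t * w)%C l ->
  derivable_pt_lim (fun t => Re (E (t * w)%C)) t (Re (l * w)%C) /\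
  derivable_pt_lim (fun t => Im (E (t * w)%C)) t (Im (l * w)%C).
Proof.
intros H.
assert (K : forall eps, 0 < eps -> exists delta : posreal, forall h, h <> 0 ->
  Rabs h < delta ->
  Cmod (E (RtoC (t + h) * w) - E (RtoC t * w) - RtoC h * (l * w))%C / Rabs h < eps).
{ intros eps Heps. pose proof (Cmod_ge_0 w) as Hw0.
  destruct (H (eps / (Cmod w + 1))) as (d & Hd & Hw); [apply Rdiv_lt_0_compat; lra|].
  assert (Hd' : 0 < d / (Cmod w + 1)) by (apply Rdiv_lt_0_compat; lra).
  exists (mkposreal _ Hd'). intros h Hh Hhd. simpl in Hhd.
  pose proof (Rabs_pos_lt h Hh) as Hha.
  specialize (Hw (RtoC (t + h) * w)%C).
  replace (RtoC (t + h) * w - RtoC t * w)%C with (RtoC h * w)%C in Hw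
    by (rewrite RtoC_plus; ring).
  rewrite Cmod_mult, Cmod_R in Hw.
  apply Rlt_div_l; [exact Hha|].
  replace (RtoC h * (l * w))%C with (l * (RtoC h * w))%C by ring.
  apply Rlt_div_r in Hhd; [|lra].
  eapply Rle_lt_trans; [apply Hw; nra|].
  apply Rlt_le_trans with (eps / (Cmod w + 1) * ((Cmod w + 1) * Rabs h)).
  - rewrite (Rmult_comm (Rabs h)). apply Rmult_lt_compat_l; [apply Rdiv_lt_0_compat; lra | nra].
  - right. field. lra. }
split; intros eps Heps; destruct (K eps Heps) as [d Hd]; exists d; intros h Hh Hhd;
  (eapply Rle_lt_trans; [|exact (Hd h Hh Hhd)]); pose proof (Rabs_pos_lt h Hh) as Hha.
- replace ((Re (E (RtoC (t + h) * w)%C) - Re (E (RtoC t * w)%C)) / h - Re (l * w)%C)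
    with (Re (E (RtoC (t + h) * w) - E (RtoC t * w) - RtoC h * (l * w))%C / h).
  + unfold Rdiv. rewrite Rabs_mult, Rabs_inv. apply Rmult_le_compat_r; [|apply re_le_Cmod].
    now apply Rlt_le, Rinv_0_lt_compat.
  + generalize (l * w)%C (E (RtoC (t + h) * w)%C) (E (RtoC t * w)%C).
    intros a b c. unfold Re; simpl. field. exact Hh.
- replace ((Im (E (RtoC (t + h) * w)%C) - Im (E (RtoC t * w)%C)) / h - Im (l * w)%C)
    with (Im (E (RtoC (t + h) * w) - E (RtoC t * w) - RtoC h * (l * w))%C / h).
  + unfold Rdiv. rewrite Rabs_mult, Rabs_inv. apply Rmult_le_compat_r; [|apply im_Cmod].
    now apply Rlt_le, Rinv_0_lt_compat.
  + generalize (l * w)%C (E (RtoC (t + h) * w)%C) (E (RtoC t * w)%C).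
    intros a b c. unfold Im; simpl. field. exact Hh.
Qed.

(** The real mean value theorem is applied to real and imaginary parts separately, which costs the
    factor 2. *)
Lemma segment_mean_value (E dE : C -> C) (w : C) (B : R) :
  (forall t, 0 <= t <= 1 -> cdiff E (t * w)%C (dE (t * w)%C)) ->
  (forall t, 0 <= t <= 1 -> Cmod (dE (t * w)%C) <= B) ->
  Cmod (E w - E 0)%C <= 2 * (B * Cmod w).
Proof.
intros Hd HB.
assert (Hb : forall t, 0 < t < 1 -> Cmod (dE (RtoC t * w) * w)%C <= B * Cmod w).
{ intros t Ht. rewrite Cmod_mult. apply Rmult_le_compat_r; [apply Cmod_ge_0 | apply HB; lra]. }
eapply Rle_trans; [apply Cmod_le_abs|].
replace w with (RtoC 1 * w)%C at 1 2 by ring. replace (RtoC 0) with (RtoC 0 * w)%C by ring.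
replace (2 * (B * Cmod w)) with (B * Cmod w + B * Cmod w) by ring.
apply Rplus_le_compat.
- destruct (MVT_cor2 (fun t => Re (E (RtoC t * w)%C)) (fun t => Re (dE (RtoC t * w) * w)%C) 0 1)
    as (c & Hc & Hc01); [lra | intros t Ht; apply derivable_segment, Hd, Ht |].
  change (Re (E (RtoC 1 * w) - E (RtoC 0 * w))%C)
    with (Re (E (RtoC 1 * w)%C) - Re (E (RtoC 0 * w)%C)).
  cbv beta in Hc. rewrite Hc, Rminus_0_r, Rmult_1_r.
  eapply Rle_trans; [apply re_le_Cmod | now apply Hb].
- destruct (MVT_cor2 (fun t => Im (E (RtoC t * w)%C)) (fun t => Im (dE (RtoC t * w) * w)%C) 0 1)
    as (c & Hc & Hc01); [lra | intros t Ht; apply derivable_segment, Hd, Ht |].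
  change (Im (E (RtoC 1 * w) - E (RtoC 0 * w))%C)
    with (Im (E (RtoC 1 * w)%C) - Im (E (RtoC 0 * w)%C)).
  cbv beta in Hc. rewrite Hc, Rminus_0_r, Rmult_1_r.
  eapply Rle_trans; [apply im_Cmod | now apply Hb].
Qed.

(** Since [q <= r^2] for [r^2 = (1 + q) / 2], one factor [r ^ n] tames [INR n + 1] by Bernoulli's
    inequality ([poly]) and the other tends to 0. *)
Lemma pow_INR_small (q eps : R) : 0 <= q < 1 -> 0 < eps ->
  exists n0 : nat, forall n, (n0 <= n)%nat -> (INR n + 1) * q ^ n < eps.
Proof.
intros Hq Heps. set (r := sqrt ((1 + q) / 2)).
assert (Hr2 : r * r = (1 + q) / 2) by (apply sqrt_sqrt; lra).
assert (Hr0 : 0 < r) by (apply sqrt_lt_R0; lra).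
assert (Hr1 : r < 1) by nra.
set (h := / r - 1).
assert (Hh : 0 < h).
{ unfold h. pose proof (Rinv_lt_contravar r 1 ltac:(lra) Hr1) as H. rewrite Rinv_1 in H. lra. }
assert (HC : 0 < 1 + / h) by (pose proof (Rinv_0_lt_compat h Hh); lra).
assert (Hk : forall n, (INR n + 1) * r ^ n <= 1 + / h).
{ intros n. pose proof (poly n h Hh) as Hp. replace (1 + h) with (/ r) in Hp by (unfold h; ring).
  rewrite pow_inv in Hp. pose proof (pow_lt r n Hr0) as Hrn. pose proof (pos_INR n) as Hn.
  assert (H1 : (1 + INR n * h) * r ^ n <= 1).
  { apply (Rmult_le_compat_r (r ^ n)) in Hp; [|lra]. now rewrite Rinv_l in Hp by lra. }
  assert (H2 : INR n + 1 <= (1 + / h) * (1 + INR n * h)).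
  { replace ((1 + / h) * (1 + INR n * h)) with (1 + / h + INR n * h + INR n) by (field; lra).
    pose proof (Rinv_0_lt_compat h Hh). nra. }
  apply Rle_trans with ((1 + / h) * ((1 + INR n * h) * r ^ n)); [|nra].
  rewrite <- Rmult_assoc. apply Rmult_le_compat_r; lra. }
destruct (pow_lt_1_zero r) with (y := eps / (1 + / h)) as [n0 Hn0].
- rewrite Rabs_right; lra.
- now apply Rdiv_lt_0_compat.
- exists n0. intros n Hn. specialize (Hn0 n Hn). specialize (Hk n).
  pose proof (pow_lt r n Hr0) as Hrn.
  rewrite Rabs_right in Hn0 by lra. apply Rlt_div_r in Hn0; [|exact HC].
  pose proof (pos_INR n) as HnI.
  apply Rle_lt_trans with ((INR n + 1) * (r ^ n * r ^ n)).
  + rewrite <- Rpow_mult_distr, Hr2. apply Rmult_le_compat_l; [lra|].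
    apply pow_incr. lra.
  + nra.
Qed.

(* The binomial coefficients [(-1)^k binom(i, k)] of [(1 - w)^i]. *)
Fixpoint osc_coef (k : nat) : C :=
  match k with
  | O => 1
  | S k => (osc_coef k * (INR k - Ci) / (INR k + 1)%R)%C
  end.

Definition osc (w : C) : C := Cexp (Ci * Clog (1 - w)).

(** Every factor [(k - i) / (k + 1)] has modulus at most 1. *)
Lemma Cmod_osc_coef (k : nat) : Cmod (osc_coef k) <= 1.
Proof.
induction k as [|k IH]; simpl; [rewrite Cmod_1; lra|].
pose proof (pos_INR k) as Hk.
assert (Hk1 : RtoC (INR k + 1) <> 0) by (intros E; apply RtoC_inj in E; lra).
rewrite Cmod_div, Cmod_mult, Cmod_R, (Rabs_right (INR k + 1)) by (trivial || lra).
apply Rle_div_l; [lra|].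
assert (H : Cmod (INR k - Ci)%C <= INR k + 1).
{ eapply Rle_trans; [apply Cmod_triangle|].
  rewrite Cmod_opp, Cmod_R, Cmod_Ci, Rabs_right; lra. }
apply Rmult_le_compat; try apply Cmod_ge_0; assumption.
Qed.

Fixpoint osc_poly (n : nat) (w : C) : C :=
  match n with
  | O => 1
  | S n => (osc_poly n w + osc_coef (S n) * w ^ S n)%C
  end.

Lemma cdiff_pow (n : nat) (w : C) :
  cdiff (fun w => w ^ S n)%C w ((INR n + 1)%R * w ^ n)%C.
Proof.
induction n as [|n IH].
- eapply cdiff_eq; [|simpl].
  + apply (cdiff_ext_near (fun w => w) _ _ _ 1); [lra | |apply cdiff_id].
    intros v _. simpl. ring.
  + rewrite Rplus_0_l. ring.
- eapply cdiff_eq.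
  + exact (cdiff_mult (fun w => w) (fun w => w ^ S n)%C _ _ _ (cdiff_id w) IH).
  + rewrite S_INR, !RtoC_plus. simpl. ring.
Qed.

(* [(1 - w)^i] solves [(1 - w) y' + i y = 0]; its Taylor polynomials do so up to
   their last term. *)
Lemma cdiff_osc_poly (n : nat) (w : C) : exists l, cdiff (osc_poly n) w l /\
  ((1 - w) * l + Ci * osc_poly n w = - (INR n - Ci) * osc_coef n * w ^ n)%C.
Proof.
induction n as [|n (l & Hl & E)].
- exists 0. split; [apply cdiff_const|]. simpl. ring.
- exists (l + osc_coef (S n) * ((INR n + 1)%R * w ^ n))%C. split.
  + apply (cdiff_plus _ _ _ _ _ Hl). apply cdiff_scal, cdiff_pow.
  + assert (Hc : ((INR n + 1)%R * osc_coef (S n) = (INR n - Ci) * osc_coef n)%C).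
    { simpl. field. intros E'. apply RtoC_inj in E'. pose proof (pos_INR n). lra. }
    rewrite S_INR. cbn [osc_poly Cpow].
    set (c := osc_coef (S n)) in *. set (P := osc_poly n w) in *. set (N := RtoC (INR n + 1)) in *.
    transitivity ((1 - w) * l + Ci * P + (N * c) * w ^ n
      + (- (N - Ci) * c * (w * w ^ n)))%C; [ring|].
    rewrite E, Hc. ring.
Qed.

Lemma Re_1_minus (w : C) : Cmod w < 1 -> 0 < Re (1 - w).
Proof.
intros H. pose proof (re_le_Cmod w) as Hr. pose proof (Rle_abs (Re w)).
change (0 < 1 - Re w). lra.
Qed.

Lemma exp_monotone (x y : R) : x <= y -> exp x <= exp y.
Proof.
intros [H | ->]; [now apply Rlt_le, exp_increasing | apply Rle_refl].
Qed.

(** [|z^i| = exp (- arg z)], and the argument is an arctangent, so it lies between [- PI / 2] and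
    [PI / 2] for every [z]. *)
Lemma Cmod_Cexp_Ci_Clog (z : C) :
  exp (- (PI / 2)) <= Cmod (Cexp (Ci * Clog z)) <= exp (PI / 2) /\
  Cmod (Cexp (- (Ci * Clog z))) <= exp (PI / 2).
Proof.
rewrite !Cmod_Cexp. destruct (atan_bound (Im z / Re z)) as [H1 H2].
replace (Re (Ci * Clog z)%C) with (- atan (Im z / Re z))
  by (unfold Clog, Ci, Re, Im; simpl; ring).
replace (Re (- (Ci * Clog z))%C) with (atan (Im z / Re z))
  by (unfold Clog, Ci, Re, Im; simpl; ring).
repeat split; apply exp_monotone; lra.
Qed.

Lemma Clog_1 : Clog 1 = 0.
Proof.
unfold Clog. rewrite Cmod_1, ln_1. simpl. rewrite Rdiv_0_l, atan_0. reflexivity.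
Qed.

Lemma cdiff_Clog_1_minus (w : C) : Cmod w < 1 ->
  cdiff (fun v => Clog (1 - v)) w (- / (1 - w))%C.
Proof.
intros Hw. eapply cdiff_eq.
- apply (cdiff_comp (fun v => 1 - v)%C Clog _ (- (1))%C).
  + apply (cdiff_ext_near (fun v => 1 + - (1) * v)%C _ _ _ 1); [lra| |].
    * intros v _. ring.
    * eapply cdiff_eq; [apply cdiff_plus; [apply cdiff_const|]; apply cdiff_scal, cdiff_id|].
      ring.
  + now apply cdiff_Clog, Re_1_minus.
- ring.
Qed.

Lemma cdiff_power (a w : C) : Cmod w < 1 ->
  cdiff (fun v => Cexp (a * Clog (1 - v))) w
    (Cexp (a * Clog (1 - w)) * (a * - / (1 - w)))%C.
Proof.
intros Hw. apply (cdiff_comp (fun v => a * Clog (1 - v))%C Cexp).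
- apply cdiff_scal, cdiff_Clog_1_minus, Hw.
- apply cdiff_Cexp.
Qed.

Lemma cdiff_osc (w : C) : Cmod w < 1 -> exists l, cdiff osc w l.
Proof. intros Hw. eexists. now apply cdiff_power. Qed.

(** Variation of constants: [E = osc_poly n * (1 - v)^{-i}] equals 1 at 0, and by the differential
    equation its derivative contains only the last Taylor term. Integrating along the segment to [w]
    and multiplying by [osc w] gives the error. *)
Lemma osc_poly_error (n : nat) (w : C) : Cmod w < 1 ->
  Cmod (osc_poly n w - osc w) <=
    2 * exp (PI / 2) * exp (PI / 2) / (1 - Cmod w) * ((INR n + 1) * Cmod w ^ n).
Proof.
intros Hw. pose proof (Cmod_ge_0 w) as Hw0.
set (E := fun v => (osc_poly n v * Cexp (- (Ci * Clog (1 - v))))%C).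
set (dE := fun v => (Cexp (- (Ci * Clog (1 - v))) * (/ (1 - v))
  * (- (INR n - Ci) * osc_coef n * v ^ n))%C).
assert (Hseg : forall t, 0 <= t <= 1 -> Cmod (RtoC t * w)%C <= Cmod w).
{ intros t Ht. rewrite Cmod_mult, Cmod_R, Rabs_right; nra. }
assert (Hne : forall v, Cmod v < 1 -> (1 - v)%C <> 0).
{ intros v Hv. apply Cmod_gt_0, Cmod_pos_Re, Re_1_minus, Hv. }
pose proof (exp_pos (PI / 2)) as Hex.
assert (HMV : Cmod (E w - E 0)%C <=
  2 * (exp (PI / 2) * / (1 - Cmod w) * ((INR n + 1) * Cmod w ^ n) * Cmod w)).
{ apply (segment_mean_value E dE).
  - intros t Ht. set (v := (RtoC t * w)%C).
    assert (Hv : Cmod v < 1) by (eapply Rle_lt_trans; [now apply Hseg | exact Hw]).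
    destruct (cdiff_osc_poly n v) as (l & Hl & El).
    eapply cdiff_eq.
    + apply (cdiff_ext_near
        (fun v => osc_poly n v * Cexp (- Ci * Clog (1 - v)))%C _ _ _ 1); [lra| |].
      { intros u _. unfold E. do 2 f_equal. ring. }
      exact (cdiff_mult _ _ _ _ _ Hl (cdiff_power (- Ci) v Hv)).
    + unfold dE. rewrite <- El.
      replace (- Ci * Clog (1 - v))%C with (- (Ci * Clog (1 - v)))%C by ring.
      field. now apply Hne.
  - intros t Ht. set (v := (RtoC t * w)%C).
    assert (Hv : Cmod v <= Cmod w) by now apply Hseg.
    assert (Hv1 : Cmod v < 1) by lra.
    unfold dE. rewrite !Cmod_mult, Cmod_inv, Cmod_opp by now apply Hne.
    apply Rmult_le_compat.
    + apply Rmult_le_pos; [apply Cmod_ge_0|].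
      apply Rlt_le, Rinv_0_lt_compat, Cmod_gt_0, Hne, Hv1.
    + repeat apply Rmult_le_pos; apply Cmod_ge_0.
    + apply Rmult_le_compat; [apply Cmod_ge_0 | | apply Cmod_Cexp_Ci_Clog |].
      * apply Rlt_le, Rinv_0_lt_compat, Cmod_gt_0, Hne, Hv1.
      * apply Rinv_le_contravar; [lra|].
        pose proof (Cmod_triangle_sub 1 v) as T. rewrite Cmod_1 in T. lra.
    + rewrite Cmod_pow. apply Rmult_le_compat.
      * apply Rmult_le_pos; apply Cmod_ge_0.
      * apply pow_le, Cmod_ge_0.
      * rewrite <- (Rmult_1_r (INR n + 1)).
        apply Rmult_le_compat; try apply Cmod_ge_0; [|apply Cmod_osc_coef].
        eapply Rle_trans; [apply Cmod_triangle|].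
        rewrite Cmod_opp, Cmod_R, Cmod_Ci, Rabs_right; [lra | apply Rle_ge, pos_INR].
      * apply pow_incr. split; [apply Cmod_ge_0 | exact Hv]. }
assert (E0 : E 0 = 1).
{ unfold E. replace (1 - 0)%C with (RtoC 1) by ring. rewrite Clog_1.
  replace (- (Ci * 0))%C with (RtoC 0) by ring. rewrite Cexp_0.
  replace (osc_poly n 0) with (RtoC 1); [ring|].
  clear. induction n as [|n IH]; [reflexivity|]. cbn [osc_poly Cpow]. rewrite <- IH. ring. }
replace (osc_poly n w - osc w)%C with (osc w * (E w - E 0))%C.
- rewrite Cmod_mult. set (q := (INR n + 1) * Cmod w ^ n) in *.
  assert (Hq : 0 <= q).
  { apply Rmult_le_pos; [pose proof (pos_INR n); lra | now apply pow_le]. }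
  clearbody q.
  assert (Hi : 0 < / (1 - Cmod w)) by (apply Rinv_0_lt_compat; lra).
  assert (Ho : Cmod (osc w) <= exp (PI / 2)) by apply Cmod_Cexp_Ci_Clog.
  apply Rle_trans with (exp (PI / 2) * (2 * (exp (PI / 2) * / (1 - Cmod w) * q))).
  + apply Rmult_le_compat; try apply Cmod_ge_0; [exact Ho|].
    eapply Rle_trans; [exact HMV|]. apply Rmult_le_compat_l; [lra|].
    assert (HX : 0 <= exp (PI / 2) * / (1 - Cmod w) * q) by
      (repeat apply Rmult_le_pos; lra).
    nra.
  + right. field. lra.
- rewrite E0. unfold E, osc. pose proof (Cexp_opp (Ci * Clog (1 - w))) as H.
  transitivity (osc_poly n w * (Cexp (Ci * Clog (1 - w)) * Cexp (- (Ci * Clog (1 - w))))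
    - Cexp (Ci * Clog (1 - w)))%C; [ring|].
  rewrite H. ring.
Qed.

Lemma filterlim_C_seq (u : nat -> C) (l : C) :
  (forall eps, 0 < eps -> exists n0 : nat, forall n, (n0 <= n)%nat -> Cmod (u n - l) < eps) ->
  filterlim u eventually (locally (T := C_UniformSpace) l).
Proof.
intros H P HP. apply locally_C in HP. destruct HP as [e He].
destruct (H e (cond_pos e)) as [n0 Hn]. exists n0. intros n Hn'.
apply He. exact (Hn n Hn').
Qed.

Lemma is_series_osc (w : C) : Cmod w < 1 ->
  is_series (K := C_AbsRing) (V := C_NormedModule) (fun k => osc_coef k * w ^ k)%C (osc w).
Proof.
intros Hw. apply filterlim_C_seq. intros eps Heps.
pose proof (Cmod_ge_0 w) as Hw0. pose proof (exp_pos (PI / 2)) as Hex.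
set (B := 2 * exp (PI / 2) * exp (PI / 2) / (1 - Cmod w)).
assert (HB : 0 < B) by (apply Rdiv_lt_0_compat; [repeat apply Rmult_lt_0_compat|]; lra).
destruct (pow_INR_small (Cmod w) (eps / B)) as [n0 Hn0]; [lra | now apply Rdiv_lt_0_compat|].
exists n0. intros n Hn.
replace (sum_n (G := C_NormedModule) (fun k => osc_coef k * w ^ k)%C n) with (osc_poly n w).
- eapply Rle_lt_trans; [now apply osc_poly_error|]. fold B.
  specialize (Hn0 n Hn). apply Rlt_div_r in Hn0; lra.
- clear. induction n as [|n IH].
  + rewrite sum_O. simpl. ring.
  + rewrite sum_Sn, <- IH. reflexivity.
Qed.

(** * Power series in [n^{-s}] as elements of [H^infinity] *)

Lemma extend_val (f : half_plane -> C) (s : half_plane) : extend f s = f s.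
Proof.
destruct s as [z Hz]. unfold extend. simpl.
destruct (Rlt_dec 0 (Re z)) as [H|H]; [|contradiction].
now rewrite (proof_irrelevance _ H Hz).
Qed.

Lemma Hinf_cdiff (f : Hinf) (z : C) : 0 < Re z -> exists l, cdiff (extend f) z l.
Proof.
intros Hz. destruct (Hinf_analytic f (exist _ z Hz)) as [l Hl].
exists l. now apply is_derive_cdiff.
Qed.

Lemma Re_near_pos (z w : C) : Cmod (w - z) < Re z -> 0 < Re w.
Proof.
intros H. pose proof (re_le_Cmod (w - z)) as Hr.
change (Re (w - z)) with (Re w - Re z) in Hr. apply Rabs_le_between in Hr. lra.
Qed.

Lemma analytic_intro (f : half_plane -> C) (g : C -> C) :
  (forall s, f s = g s) -> (forall z, 0 < Re z -> exists l, cdiff g z l) -> analytic f.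
Proof.
intros E Hg s. destruct (Hg s (proj2_sig s)) as [l Hl]. exists l.
apply is_derive_cdiff. refine (cdiff_ext_near g _ _ _ (Re s) (proj2_sig s) _ Hl).
intros w Hw.
set (w' := exist _ w (Re_near_pos _ _ Hw) : half_plane).
change w with (hp_val w'). now rewrite extend_val, E.
Qed.

Lemma cdiff_dirichlet_term (n : nat) (z : C) : exists l, cdiff (dirichlet_term n) z l.
Proof.
eexists. apply (cdiff_ext_near (fun s => Cexp (- ln (INR n) * s))%C _ _ _ 1); [lra| |].
- intros w _. unfold dirichlet_term. f_equal. ring.
- apply (cdiff_comp (fun s => - ln (INR n) * s)%C Cexp).
  + apply cdiff_scal, cdiff_id.
  + apply cdiff_Cexp.
Qed.

Lemma Cmod_dirichlet_term (n : nat) (z : C) :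
  Cmod (dirichlet_term n z) = exp (- (Re z * ln (INR n))).
Proof.
unfold dirichlet_term. rewrite Cmod_Cexp. f_equal. unfold Re; simpl. ring.
Qed.

Lemma ln_INR_pos (n : nat) : (2 <= n)%nat -> 0 < ln (INR n).
Proof.
intros Hn. rewrite <- ln_1. apply ln_increasing; [lra|].
apply le_INR in Hn. simpl in Hn. lra.
Qed.

Lemma Cmod_dirichlet_term_lt_1 (n : nat) (z : C) : (2 <= n)%nat -> 0 < Re z ->
  Cmod (dirichlet_term n z) < 1.
Proof.
intros Hn Hz. rewrite Cmod_dirichlet_term, <- exp_0. apply exp_increasing.
pose proof (ln_INR_pos n Hn). nra.
Qed.

Lemma dirichlet_term_pow (n k : nat) (z : C) : (0 < n)%nat ->
  dirichlet_term (n ^ k) z = (dirichlet_term n z ^ k)%C.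
Proof.
intros Hn. unfold dirichlet_term.
assert (HN : 0 < INR n) by now apply lt_0_INR.
induction k as [|k IH].
- simpl. rewrite ln_1, <- Cexp_0. f_equal. ring.
- assert (Hk : 0 < INR (n ^ k)) by (rewrite pow_INR; now apply pow_lt).
  rewrite Nat.pow_succ_r', mult_INR, ln_mult, RtoC_plus by assumption.
  simpl Cpow. rewrite <- IH, <- Cexp_plus. f_equal. ring.
Qed.

Definition power_coef (n : nat) (c : nat -> C) (m : nat) : C :=
  match excluded_middle_informative (exists k, m = (n ^ k)%nat) with
  | left H => c (proj1_sig (constructive_indefinite_description _ H))
  | right _ => 0
  end.

Lemma power_coef_pow (n : nat) (c : nat -> C) (k : nat) : (2 <= n)%nat ->
  power_coef n c (n ^ k) = c k.
Proof.
intros Hn. unfold power_coef.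
destruct (excluded_middle_informative _) as [H|H].
- f_equal. destruct (constructive_indefinite_description _ H) as [j Hj]; simpl.
  symmetry. exact (Nat.pow_inj_r n k j ltac:(lia) Hj).
- destruct H. now exists k.
Qed.

Lemma power_coef_other (n : nat) (c : nat -> C) (m k : nat) : (2 <= n)%nat ->
  (n ^ k < m)%nat -> (m < n ^ S k)%nat -> power_coef n c m = 0.
Proof.
intros Hn H1 H2. unfold power_coef.
destruct (excluded_middle_informative _) as [[j ->]|H]; [exfalso|reflexivity].
apply Nat.pow_lt_mono_r_iff in H1, H2; lia.
Qed.

(** The coefficients vanish off the powers of [n], so the partial sum up to [S m] is the partial sum
    of the power series up to the last [k] with [n ^ k <= S m]. *)
Lemma power_series_dirichlet (n : nat) (c : nat -> C) (s l : C) : (2 <= n)%nat ->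
  is_series (K := C_AbsRing) (V := C_NormedModule)
    (fun k => c k * dirichlet_term n s ^ k)%C l ->
  is_dirichlet_series (power_coef n c) s l.
Proof.
intros Hn H.
assert (Part : forall m, exists k, (n ^ k <= S m < n ^ S k)%nat /\
  sum_n (G := C_NormedModule)
    (fun m => power_coef n c (S m) * dirichlet_term (S m) s)%C m
  = sum_n (G := C_NormedModule) (fun k => c k * dirichlet_term n s ^ k)%C k).
{ assert (T : forall k, (power_coef n c (n ^ k) * dirichlet_term (n ^ k) s
    = c k * dirichlet_term n s ^ k)%C).
  { intros k. rewrite power_coef_pow, dirichlet_term_pow by lia. reflexivity. }
  induction m as [|m (k & Hk & IH)].
  - exists 0%nat. split; [simpl; lia|]. rewrite !sum_O. exact (T 0%nat).
  - destruct (Nat.eq_dec (S (S m)) (n ^ S k)) as [E|E].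
    + exists (S k). split.
      * rewrite E. split; [lia|]. apply Nat.pow_lt_mono_r; lia.
      * rewrite !sum_Sn, IH, E, T. reflexivity.
    + exists k. split; [lia|].
      rewrite sum_Sn, IH, (power_coef_other n c (S (S m)) k) by lia.
      rewrite Cmult_0_l. exact (plus_zero_r (G := C_AbelianGroup) _). }
intros P HP. destruct (H P HP) as [k0 Hk0].
exists (n ^ k0)%nat. intros m Hm. destruct (Part m) as (k & Hk & ->).
apply Hk0. assert (L : (n ^ k0 < n ^ S k)%nat) by lia.
apply Nat.pow_lt_mono_r_iff in L; lia.
Qed.

(** Source of the monomials and of the test functions [f_tau]. As [|n^{-s}| < 1] for [Re s > 0], the
    series converges on the whole half-plane and [theta = 0] serves. *)
Lemma Hinf_of_power_series (n : nat) (h : C -> C) (c : nat -> C) (M : R) :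
  (2 <= n)%nat ->
  (forall v, Cmod v < 1 -> exists l, cdiff h v l) ->
  (forall v, Cmod v < 1 -> Cmod (h v) <= M) ->
  (forall v, Cmod v < 1 -> is_series (K := C_AbsRing) (V := C_NormedModule)
    (fun k => c k * v ^ k)%C (h v)) ->
  exists f : Hinf, forall s : half_plane, f s = h (dirichlet_term n s).
Proof.
intros Hn Hd Hb Hs.
assert (H1 : analytic (fun s => h (dirichlet_term n s))).
{ apply (analytic_intro _ (fun z => h (dirichlet_term n z))); [reflexivity|].
  intros z Hz. destruct (cdiff_dirichlet_term n z) as [l Hl].
  destruct (Hd _ (Cmod_dirichlet_term_lt_1 n z Hn Hz)) as [l' Hl'].
  exists (l' * l)%C. exact (cdiff_comp _ _ _ _ _ Hl Hl'). }
assert (H2 : bounded_fun (fun s => h (dirichlet_term n s))).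
{ exists M. intros s. apply Hb, Cmod_dirichlet_term_lt_1; [exact Hn | exact (proj2_sig s)]. }
assert (H3 : has_dirichlet_series (fun s => h (dirichlet_term n s))).
{ exists (power_coef n c), 0. intros s Hs0. apply power_series_dirichlet; [exact Hn|].
  now apply Hs, Cmod_dirichlet_term_lt_1. }
now exists (mkHinf _ H1 H2 H3).
Qed.

Lemma Hinf_monomial (n : nat) : (2 <= n)%nat ->
  exists f : Hinf, forall s : half_plane, f s = dirichlet_term n s.
Proof.
intros Hn.
apply (Hinf_of_power_series n (fun v => v) (fun k => if Nat.eq_dec k 1 then 1 else 0) 1 Hn).
- intros v _. exists 1. apply cdiff_id.
- intros v Hv. lra.
- intros v _. apply filterlim_C_seq. intros eps Heps. exists 1%nat. intros k Hk.
  assert (E : sum_n (G := C_NormedModule)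
    (fun k => (if Nat.eq_dec k 1 then 1 else 0) * v ^ k)%C k = v).
  { induction Hk as [|k Hk IH].
    - rewrite sum_Sn, sum_O. unfold plus; simpl. ring.
    - rewrite sum_Sn, IH. destruct (Nat.eq_dec (S k) 1) as [E|_]; [lia|].
      rewrite Cmult_0_l. exact (plus_zero_r (G := C_AbelianGroup) _). }
  rewrite E. replace (v - v)%C with (RtoC 0) by ring. now rewrite Cmod_0.
Qed.

Lemma Hinf_osc (n : nat) (u : C) : (2 <= n)%nat -> Cmod u = 1 ->
  exists f : Hinf, forall s : half_plane, f s = osc (u * dirichlet_term n s)%C.
Proof.
intros Hn Hu.
assert (Huv : forall v, Cmod v < 1 -> Cmod (u * v) < 1).
{ intros v Hv. now rewrite Cmod_mult, Hu, Rmult_1_l. }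
apply (Hinf_of_power_series n (fun v => osc (u * v)%C)
  (fun k => osc_coef k * u ^ k)%C (exp (PI / 2)) Hn).
- intros v Hv. destruct (cdiff_osc _ (Huv v Hv)) as [l Hl]. eexists.
  exact (cdiff_comp (fun v => u * v)%C osc v _ l
    (cdiff_scal u _ _ _ (cdiff_id v)) Hl).
- intros v Hv. apply Cmod_Cexp_Ci_Clog.
- intros v Hv.
  apply (is_series_ext (fun k => osc_coef k * (u * v) ^ k)%C); [|now apply is_series_osc, Huv].
  intros k. rewrite Cpow_mult_l. apply Cmult_assoc.
Qed.

(** * Semigroups *)

(** [ln |1 - w|] is the phase of [(1 - w)^i]. A difference of [PI] is a half-turn, so
    [osc v = - exp r * osc w], and the distance is at least [|osc w| >= exp (- (PI / 2))]. *)
Lemma osc_gap (v w : C) :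
  Rabs (ln (Cmod (1 - v)) - ln (Cmod (1 - w))) = PI ->
  exp (- (PI / 2)) <= Cmod (osc v - osc w).
Proof.
intros H.
set (d := ln (Cmod (1 - v)) - ln (Cmod (1 - w))) in H.
set (r := atan (Im (1 - w)%C / Re (1 - w)%C) - atan (Im (1 - v)%C / Re (1 - v)%C)).
assert (E : osc v = (- exp r * osc w)%C).
{ unfold osc.
  replace (Ci * Clog (1 - v))%C with (Cplus (r, d) (Ci * Clog (1 - w)))%C
    by (unfold Clog, r, d; apply injective_projections; simpl; ring).
  rewrite Cexp_plus. f_equal. unfold Cexp; simpl.
  assert (Hcs : cos d = -1 /\ sin d = 0).
  { destruct (Rcase_abs d) as [Hd|Hd].
    - rewrite Rabs_left in H by exact Hd. replace d with (- PI) by lra.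
      now rewrite cos_neg, sin_neg, cos_PI, sin_PI, Ropp_0.
    - rewrite Rabs_right in H by exact Hd. rewrite H. now rewrite cos_PI, sin_PI. }
  destruct Hcs as [-> ->]. apply injective_projections; simpl; ring. }
rewrite E. replace (- exp r * osc w - osc w)%C with (RtoC (- (exp r + 1)) * osc w)%C
  by (rewrite RtoC_opp, RtoC_plus; ring).
rewrite Cmod_mult, Cmod_R, Rabs_Ropp, Rabs_right by (pose proof (exp_pos r); lra).
destruct (Cmod_Cexp_Ci_Clog (1 - w)) as [[Hl _] _]. fold (osc w) in Hl.
pose proof (exp_pos r). pose proof (exp_pos (- (PI / 2))). nra.
Qed.

Lemma continuity_ln_path (h : C -> C) (z w : C) (t : R) :
  ccont h (z + t * w)%C -> Cmod (h (z + t * w)%C) < 1 ->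
  continuity_pt (fun t => ln (Cmod (1 - h (z + RtoC t * w)%C))) t.
Proof.
intros Hc Hm.
apply (continuity_pt_comp (fun t => Cmod (1 - h (z + RtoC t * w)%C)) ln).
- intros eps Heps. destruct (Hc eps Heps) as (d & Hd & Hw).
  pose proof (Cmod_ge_0 w) as Hw0.
  exists (d / (Cmod w + 1)). split; [apply Rdiv_lt_0_compat; lra|].
  intros t' [_ Ht']. simpl in *. unfold R_dist in *.
  apply Rlt_div_r in Ht'; [|lra].
  assert (H : Cmod (z + RtoC t' * w - (z + RtoC t * w))%C < d).
  { replace (z + RtoC t' * w - (z + RtoC t * w))%C with (RtoC (t' - t) * w)%C
      by (rewrite RtoC_minus; ring).
    rewrite Cmod_mult, Cmod_R. pose proof (Rabs_pos (t' - t)). nra. }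
  specialize (Hw _ H).
  set (a := h (z + RtoC t' * w)%C) in *. set (b := h (z + RtoC t * w)%C) in *.
  pose proof (Cmod_triangle_sub (1 - a) (1 - b)) as T1.
  pose proof (Cmod_triangle_sub (1 - b) (1 - a)) as T2.
  replace (1 - a - (1 - b))%C with (b - a)%C in T1 by ring.
  replace (1 - b - (1 - a))%C with (a - b)%C in T2 by ring.
  rewrite (Cmod_sub_sym b) in T1. apply Rabs_def1; lra.
- apply derivable_continuous_pt. eexists. apply derivable_pt_lim_ln.
  now apply Cmod_pos_Re, Re_1_minus.
Qed.

(* The logarithmic ratio starts below [PI] in modulus and, by [osc_gap], can
   never cross that value. *)
Lemma log_ratio_bound (h k : C -> C) (z0 : C) :
  (forall z : C, 0 < Re z -> ccont h z /\ ccont k z /\ Cmod (h z) < 1 /\ Cmod (k z) < 1 /\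
    Cmod (osc (h z) - osc (k z)) < exp (- (PI / 2))) ->
  0 < Re z0 ->
  Rabs (ln (Cmod (1 - h z0)) - ln (Cmod (1 - k z0))) < PI ->
  forall z : C, 0 < Re z -> Cmod (1 - h z) <= exp PI * Cmod (1 - k z).
Proof.
intros H Hz0 H0 z Hz.
set (D := fun v => ln (Cmod (1 - h v)) - ln (Cmod (1 - k v))).
assert (HD : Rabs (D z) < PI).
{ apply Rnot_le_lt. intros Hc.
  (* Along the segment from [z0] to [z] this is negative at 0 and, under the assumption to be
     refuted, nonnegative at 1, while [osc_gap] excludes a zero. *)
  set (f := fun t => Rabs (D (z0 + RtoC t * (z - z0))%C) - PI).
  assert (Hpath : forall t, 0 <= t <= 1 -> 0 < Re (z0 + RtoC t * (z - z0))%C).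
  { intros t Ht. replace (Re (z0 + RtoC t * (z - z0))%C) with ((1 - t) * Re z0 + t * Re z)
      by (unfold Re; simpl; ring). nra. }
  assert (E1 : (z0 + RtoC 1 * (z - z0))%C = z) by ring.
  assert (E0 : (z0 + RtoC 0 * (z - z0))%C = z0) by ring.
  assert (Hne : forall t, 0 <= t <= 1 -> f t <> 0).
  { intros t Ht Hf. destruct (H _ (Hpath t Ht)) as (_ & _ & _ & _ & Ho).
    assert (G := osc_gap (h (z0 + RtoC t * (z - z0))%C) (k (z0 + RtoC t * (z - z0))%C)).
    unfold f, D in Hf. specialize (G ltac:(lra)). lra. }
  destruct (IVT_interv f 0 1) as (t & Ht & Hft).
  - intros t Ht. unfold f. apply continuity_pt_minus; [|apply continuity_pt_const; easy].
    apply (continuity_pt_comp (fun t => D (z0 + RtoC t * (z - z0))%C) Rabs);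
      [|apply Rcontinuity_abs].
    destruct (H _ (Hpath t Ht)) as (C1 & C2 & M1 & M2 & _).
    apply continuity_pt_minus; now apply continuity_ln_path.
  - lra.
  - unfold f. rewrite E0. unfold D. lra.
  - assert (f 1 <> 0) by (apply Hne; lra). unfold f in *. rewrite E1 in *. lra.
  - exact (Hne t Ht Hft). }
destruct (H z Hz) as (_ & _ & M1 & M2 & _).
pose proof (Cmod_pos_Re _ (Re_1_minus _ M1)) as P1.
pose proof (Cmod_pos_Re _ (Re_1_minus _ M2)) as P2.
rewrite <- (exp_ln _ P1), <- (exp_ln _ P2) at 1. rewrite <- exp_plus.
apply exp_monotone. apply Rabs_def2 in HD. unfold D in HD. lra.
Qed.

(** If no [E n] were dense in any interval, nested closed intervals could be chosen, the one at
    stage [S n] avoiding [E n]; their common point would lie in no [E n]. *)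
Lemma dense_in_interval (E : nat -> R -> Prop) : (forall x, exists n, E n x) ->
  exists n a b, a < b /\
    forall c d, a <= c -> c < d -> d <= b -> exists x, c < x < d /\ E n x.
Proof.
intros HE. apply NNPP. intros Hno.
set (step := fun (n : nat) (p q : R * R) => fst p < snd p ->
  fst p <= fst q /\ fst q < snd q /\ snd q <= snd p /\
  forall x, fst q <= x <= snd q -> ~ E n x).
destruct (dependent_choice step (0, 1)) as (u & Hu0 & Hu).
{ intros n [a b]. destruct (Rlt_dec a b) as [Hab|Hab];
    [|exists (a, b); intros H; simpl in H; contradiction].
  apply NNPP. intros Hn. apply Hno. exists n, a, b. split; [exact Hab|].
  intros c d Hac Hcd Hdb. apply NNPP. intros Hx. apply Hn.
  (* The gap [c < x < d] is open; its middle third is a closed interval inside it. *)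
  exists (c + (d - c) / 3, c + 2 * (d - c) / 3). intros _. simpl.
  repeat split; try lra. intros x Hxcd HEx. apply Hx. exists x. split; [lra | exact HEx]. }
assert (Hlt : forall n, fst (u n) < snd (u n)).
{ induction n as [|n IH]; [rewrite Hu0; simpl; lra | apply (Hu n IH)]. }
destruct (nested_intervals (fun n => fst (u n)) (fun n => snd (u n))) as [x Hx].
- intros n. apply (Hu n (Hlt n)).
- intros n. apply (Hu n (Hlt n)).
- intros n. apply Rlt_le, Hlt.
- destruct (HE x) as [n Hn]. exact (proj2 (proj2 (proj2 (Hu n (Hlt n)))) x (Hx (S n)) Hn).
Qed.

(** The segment from 0 to [w] stays where [|exp| <= 1]. *)
Lemma Cmod_1_minus_Cexp (w : C) : Re w <= 0 -> Cmod (1 - Cexp w) <= 2 * Cmod w.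
Proof.
intros Hw. rewrite Cmod_sub_sym, <- Cexp_0, <- (Rmult_1_l (Cmod w)).
apply (segment_mean_value Cexp Cexp).
- intros t _. apply cdiff_Cexp.
- intros t Ht. rewrite Cmod_Cexp, <- exp_0. apply exp_monotone.
  replace (Re (RtoC t * w)%C) with (t * Re w) by (unfold Re; simpl; ring). nra.
Qed.

(** The constant 6 is the worst ratio [(3 / 2) / (1 / 4)] in [Cmod_near]; it is admissible because
    [PI > 3] and [exp 3 > 8]. *)
Lemma ln_ratio_lt_PI (x y : R) : 0 < x -> 0 < y -> x <= 6 * y -> y <= 6 * x ->
  Rabs (ln x - ln y) < PI.
Proof.
intros Hx Hy Hxy Hyx.
assert (H6 : ln 6 < PI).
{ rewrite <- (ln_exp PI). apply ln_increasing; [lra|].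
  pose proof PI2_3_2 as Hp. unfold PI2 in Hp.
  apply Rlt_trans with (exp 3); [|apply exp_increasing; lra].
  replace 3 with (1 + 1 + 1) by ring. rewrite !exp_plus.
  pose proof (exp_ineq1 1 ltac:(lra)). nra. }
assert (K : forall a b, 0 < a -> 0 < b -> a <= 6 * b -> ln a <= ln 6 + ln b).
{ intros a b Ha Hb Hab. rewrite <- ln_mult by lra. now apply ln_le. }
pose proof (K x y Hx Hy Hxy). pose proof (K y x Hy Hx Hyx). apply Rabs_def1; lra.
Qed.

(** * Small times fix the monomials *)

Lemma small_time (T : R -> Hinf -> Hinf) (f : Hinf) (eps : R) :
  strongly_continuous_semigroup T -> 0 < eps ->
  exists d, 0 < d /\ forall t, 0 < t < d -> forall s, Cmod (T t f s - f s) < eps.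
Proof.
intros [_ HT] Heps.
destruct (HT f (fun g => Hinf_norm (minus g f) < eps)) as [d Hd].
- exists (mkposreal eps Heps). intros g Hg. exact Hg.
- exists d. split; [apply cond_pos|]. intros t Ht s.
  replace (T t f s - f s)%C with (minus (T t f) f s) by (simpl; ring).
  eapply Rle_lt_trans; [apply Hinf_norm_ub|]. apply Hd; [|lra].
  change (Rabs (t - 0) < d). rewrite Rminus_0_r, Rabs_right; lra.
Qed.

Lemma extend_ccont (f : Hinf) (z : C) : 0 < Re z -> ccont (extend f) z.
Proof.
intros Hz. destruct (Hinf_cdiff f z Hz) as [l Hl]. exact (cdiff_ccont _ _ _ Hl).
Qed.

Lemma ccont_scal (u : C) (f : C -> C) (z : C) : Cmod u = 1 ->
  ccont f z -> ccont (fun w => u * f w)%C z.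
Proof.
intros Hu H eps Heps. destruct (H eps Heps) as (d & Hd & Hw).
exists d; split; [exact Hd|]. intros w Hwd.
replace (u * f w - u * f z)%C with (u * (f w - f z))%C by ring.
rewrite Cmod_mult, Hu, Rmult_1_l. now apply Hw.
Qed.

Lemma Cmod_near (u v w : C) (r : R) : Cmod u = 1 -> Cmod v <= / 2 ->
  Cmod (w - v) < / 4 ->
  / 2 <= Cmod (1 - u * v) <= 3 / 2 /\ / 4 <= Cmod (1 - u * w) <= 7 / 4.
Proof.
intros Hu Hv Hw.
assert (Hb : forall x, Cmod x <= 3 / 4 ->
  1 - Cmod x <= Cmod (1 - u * x) <= 1 + Cmod x).
{ intros x Hx. assert (E : Cmod (u * x) = Cmod x) by now rewrite Cmod_mult, Hu, Rmult_1_l.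
  pose proof (Cmod_triangle_sub 1 (u * x)) as T1.
  pose proof (Cmod_triangle 1 (- (u * x))) as T2.
  rewrite Cmod_1 in T1, T2. rewrite Cmod_opp in T2.
  rewrite E in T1, T2. unfold Cminus in *. lra. }
pose proof (Cmod_triangle_sub w v) as T.
pose proof (Hb v ltac:(lra)). pose proof (Hb w ltac:(lra)). lra.
Qed.

Lemma composition_monomial_fixed (T : R -> Hinf -> Hinf) (n : nat) :
  strongly_continuous_semigroup T ->
  (forall t, 0 <= t -> composition_operator (T t)) -> (2 <= n)%nat ->
  exists t0, 0 < t0 /\ forall t, 0 < t < t0 ->
    forall m : Hinf, (forall s, m s = dirichlet_term n s) -> forall s, T t m s = m s.
Proof.
intros HT Hcomp Hn.
destruct (Hinf_monomial n Hn) as [m Hm].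
pose proof (ln_INR_pos n Hn) as Hln.
set (u := fun tau => Cexp (0, tau * ln (INR n))).
assert (Hu : forall tau, Cmod (u tau) = 1).
{ intros tau. unfold u. rewrite Cmod_Cexp. apply exp_0. }
(* [E k tau] says that the time bound [/ (INR k + 1)] works for [tau], with the threshold of
   [osc_gap]. It ranges over all [f] with the right values because [f_tau] is known only through its
   values. *)
set (E := fun (k : nat) (tau : R) => forall f : Hinf,
  (forall s, f s = osc (u tau * dirichlet_term n s)) ->
  forall t, 0 < t < / (INR k + 1) -> forall s, Cmod (T t f s - f s) < exp (- (PI / 2))).
destruct (dense_in_interval E) as (k & a & b & Hab & Hdense).
{ intros tau. destruct (Hinf_osc n (u tau) Hn (Hu tau)) as [f Hf].
  destruct (small_time T f _ HT (exp_pos (- (PI / 2)))) as (d & Hd & Hsmall).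
  destruct (INR_unbounded (/ d)) as [k Hk]. exists k. intros f' Hf' t Ht s.
  replace f' with f by (apply Hinf_ext; intros s'; now rewrite Hf, Hf').
  apply Hsmall. split; [apply Ht|]. apply Rlt_trans with (/ (INR k + 1)); [apply Ht|].
  pose proof (Rinv_0_lt_compat d Hd). rewrite <- (Rinv_inv d).
  apply Rinv_lt_contravar; [|lra]. apply Rmult_lt_0_compat; lra. }
(* This starts the connectedness argument at [s = 1]: there [|n^{-1}| <= / 2], so closeness [/ 4]
   keeps the logarithmic ratio below [PI] for all [tau] at once. *)
destruct (small_time T m (/ 4) HT) as (d & Hd & Hsmall); [lra|].
assert (Hk : 0 < / (INR k + 1)).
{ apply Rinv_0_lt_compat. pose proof (pos_INR k). lra. }
exists (Rmin d (/ (INR k + 1))). split; [now apply Rmin_pos|].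
intros t Ht m' Hm'.
replace m' with m by (apply Hinf_ext; intros s; now rewrite Hm, Hm').
assert (Ht1 : 0 < t < d) by (pose proof (Rmin_l d (/ (INR k + 1))); lra).
assert (Ht2 : 0 < t < / (INR k + 1)) by (pose proof (Rmin_r d (/ (INR k + 1))); lra).
destruct (Hcomp t ltac:(lra)) as (_ & Phi & _ & HPhi).
assert (Hlt : forall s : half_plane, Cmod (m s) < 1 /\ Cmod (T t m s) < 1).
{ intros s. rewrite HPhi, !Hm.
  split; apply Cmod_dirichlet_term_lt_1; try exact Hn;
    [exact (proj2_sig s) | exact (proj2_sig (Phi s))]. }
(* Being composition with [Phi], [T t] sends [osc (u * n^{-s})] to [osc (u * z_t)]. The constant
   does not depend on [tau], which may therefore be chosen according to [s]. *)
assert (Hratio : forall tau, E k tau -> forall s : half_plane,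
  Cmod (1 - u tau * T t m s) <= exp PI * Cmod (1 - u tau * m s)).
{ intros tau Htau s. rewrite <- (extend_val (T t m)), <- (extend_val m).
  apply (log_ratio_bound (fun z => u tau * extend (T t m) z)%C
    (fun z => u tau * extend m z)%C 1); [| simpl; lra | | exact (proj2_sig s)].
  - intros z Hz. set (s' := exist _ z Hz : half_plane).
    repeat split.
    + apply ccont_scal; [apply Hu | now apply extend_ccont].
    + apply ccont_scal; [apply Hu | now apply extend_ccont].
    + change z with (hp_val s'). rewrite extend_val, Cmod_mult, Hu, Rmult_1_l. apply Hlt.
    + change z with (hp_val s'). rewrite extend_val, Cmod_mult, Hu, Rmult_1_l. apply Hlt.
    + change z with (hp_val s'). rewrite !extend_val.
      destruct (Hinf_osc n (u tau) Hn (Hu tau)) as [f Hf].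
      pose proof (Htau f Hf t Ht2 s') as H.
      rewrite HPhi, !Hf in H. rewrite HPhi, !Hm. exact H.
  - set (s' := exist _ (RtoC 1) Rlt_0_1 : half_plane).
    change (RtoC 1) with (hp_val s') at 2 4. rewrite !extend_val.
    assert (Hm1 : Cmod (m s') <= / 2).
    { rewrite Hm, Cmod_dirichlet_term. simpl. rewrite Rmult_1_l, exp_Ropp.
      apply le_INR in Hn. simpl in Hn. rewrite exp_ln by lra.
      apply Rinv_le_contravar; lra. }
    pose proof (Cmod_near (u tau) _ _ 1 (Hu tau) Hm1 (Hsmall t Ht1 s')).
    apply ln_ratio_lt_PI; lra. }
set (F := minus (T t m) m : Hinf).
assert (HF : forall s, F s = (T t m s - m s)%C) by (intros s; simpl; ring).
(* The triangle inequality through 1 gives [1 + exp PI]; the rest bounds [|1 - n^{-(s - i tau)}|] by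
   [2 ln n] times [|s - i tau|]. *)
set (K := (1 + exp PI) * (2 * ln (INR n))).
assert (HK : 0 < K).
{ pose proof (exp_pos PI). apply Rmult_lt_0_compat; lra. }
assert (Hzero : forall s : half_plane, extend F s = 0).
(* [tau] will lie within [Re z] of [Im z], so [|z - i tau| <= 2 * Re z], whence [2 * K]. The last 2
   bounds a difference of two values of modulus below 1. *)
{ intros s. apply (boundary_zero_at (extend F) a b (2 * K) 2).
  - apply Hinf_cdiff.
  - intros z Hz. change z with (hp_val (exist _ z Hz)). rewrite extend_val, HF.
    eapply Rle_trans; [apply Cmod_triangle|]. rewrite Cmod_opp.
    destruct (Hlt (exist _ z Hz)). lra.
  - exact Hab.
  - intros z Hz Hi. set (s' := exist _ z Hz : half_plane).
    (* The minimum with [b] keeps the search interval inside the one where good [tau] are dense. *)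
    destruct (Hdense (Im z) (Rmin b (Im z + Re z))) as (tau & Htau & HE).
    + lra.
    + apply Rmin_glb_lt; lra.
    + apply Rmin_l.
    + pose proof (Rmin_r b (Im z + Re z)).
      specialize (Hratio tau HE s').
      assert (Hw : Cmod (1 - u tau * m s') <= 2 * ln (INR n) * (2 * Re z)).
      { rewrite Hm. unfold u, dirichlet_term. rewrite <- Cexp_plus.
        set (w := Cplus (0, tau * ln (INR n)) (- (s' * RtoC (ln (INR n))))).
        assert (Hw : w = (- (Re z * ln (INR n)), (tau - Im z) * ln (INR n))).
        { unfold w. apply injective_projections; unfold Re, Im; simpl; ring. }
        eapply Rle_trans; [apply Cmod_1_minus_Cexp; rewrite Hw; simpl; nra|].
        rewrite Rmult_assoc. apply Rmult_le_compat_l; [lra|].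
        eapply Rle_trans; [apply Cmod_le_abs|]. rewrite Hw. simpl.
        rewrite Rabs_Ropp, !Rabs_right by nra. nra. }
      change z with (hp_val s') at 1. rewrite extend_val, HF.
      replace (Cmod (T t m s' - m s')) with (Cmod (1 - u tau * m s' - (1 - u tau * T t m s'))).
      * eapply Rle_trans; [apply Cmod_triangle|]. rewrite Cmod_opp. unfold K.
        pose proof (exp_pos PI). nra.
      * replace (1 - u tau * m s' - (1 - u tau * T t m s'))%C
          with (u tau * (T t m s' - m s'))%C by ring.
        now rewrite Cmod_mult, Hu, Rmult_1_l.
  - exact (proj2_sig s). }
intros s. specialize (Hzero s). rewrite extend_val, HF in Hzero.
replace (T t m s) with ((T t m s - m s) + m s)%C by ring. rewrite Hzero. ring.
Qed.

(** * A point is determined by [2^{-s}] and [3^{-s}] *)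

Lemma Cexp_eq_1 (y : R) : Cexp (0, y) = 1 -> exists k : Z, y = 2 * (IZR k * PI).
Proof.
intros H. unfold Cexp in H; simpl in H. rewrite exp_0, !Rmult_1_l in H.
injection H as Hc Hs.
destruct (sin_eq_0_0 (y / 2)) as [k Hk].
- replace y with (2 * (y / 2)) in Hc by field. rewrite cos_2a_sin in Hc. nra.
- exists k. rewrite <- Hk. field.
Qed.

Lemma pow_3_2 (a b : nat) : (3 ^ a = 2 ^ b)%nat -> a = 0%nat.
Proof.
intros H. destruct b as [|b].
- destruct a as [|a]; [reflexivity|]. exfalso.
  pose proof (Nat.pow_gt_1 3 (S a) ltac:(lia) ltac:(lia)). simpl (2 ^ 0)%nat in H. lia.
- exfalso. apply (f_equal Nat.even) in H.
  rewrite Nat.pow_succ_r', Nat.even_mul in H. simpl in H.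
  destruct a as [|a]; [discriminate|]. rewrite Nat.even_pow in H by lia. discriminate.
Qed.

(** Moduli give equal real parts. Arguments give [(Im w - Im z) ln 2 = 2 PI k] and
    [(Im w - Im z) ln 3 = 2 PI l], so [k ln 3 = l ln 2], which forces [k = 0]. *)
Lemma dirichlet_terms_separate (z w : C) :
  dirichlet_term 2 z = dirichlet_term 2 w ->
  dirichlet_term 3 z = dirichlet_term 3 w -> z = w.
Proof.
intros H2 H3.
pose proof (ln_INR_pos 2 ltac:(lia)) as L2. pose proof (ln_INR_pos 3 ltac:(lia)) as L3.
assert (HRe : Re z = Re w).
{ apply (f_equal Cmod) in H2. rewrite !Cmod_dirichlet_term in H2.
  apply exp_inv in H2. nra. }
assert (Key : forall n, dirichlet_term n z = dirichlet_term n w ->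
  exists k : Z, (Im w - Im z) * ln (INR n) = 2 * (IZR k * PI)).
{ intros n Hn. apply Cexp_eq_1.
  replace (Cexp (0, (Im w - Im z) * ln (INR n)))
    with (dirichlet_term n z * Cexp (- - (w * RtoC (ln (INR n)))))%C.
  - rewrite Hn. apply Cexp_opp.
  - unfold dirichlet_term. rewrite <- Cexp_plus. f_equal.
    apply injective_projections; unfold Re, Im in *; simpl; [rewrite HRe|]; ring. }
destruct (Key 2%nat H2) as [k Hk]. destruct (Key 3%nat H3) as [l Hl].
pose proof PI_RGT_0 as Hpi.
assert (Hkl : IZR k * ln (INR 3) = IZR l * ln (INR 2)).
{ apply (Rmult_eq_reg_l (2 * PI)); [|lra].
  replace (2 * PI * (IZR k * ln (INR 3))) with (2 * (IZR k * PI) * ln (INR 3)) by ring.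
  replace (2 * PI * (IZR l * ln (INR 2))) with (2 * (IZR l * PI) * ln (INR 2)) by ring.
  rewrite <- Hk, <- Hl. ring. }
(* Absolute values turn the relation into [3 ^ |k| = 2 ^ |l|] between natural numbers, decided by
   parity. *)
assert (Hk0 : Z.abs_nat k = 0%nat).
{ apply (pow_3_2 _ (Z.abs_nat l)). apply INR_eq. rewrite !pow_INR.
  apply ln_inv; try (apply pow_lt; apply lt_0_INR; lia).
  rewrite !ln_pow by (apply lt_0_INR; lia).
  rewrite !INR_IZR_INZ, !Zabs2Nat.id_abs, <- !INR_IZR_INZ, !abs_IZR.
  rewrite <- (Rabs_right (ln (INR 3))), <- (Rabs_right (ln (INR 2))) by lra.
  now rewrite <- !Rabs_mult, Hkl. }
assert (k = 0%Z) by lia. subst k. rewrite Rmult_0_l, Rmult_0_r in Hk.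
apply Rmult_integral in Hk. destruct Hk as [Hk|Hk]; [|lra].
apply injective_projections; [exact HRe | unfold Im in Hk; lra].
Qed.

Theorem theorem7p1 (T : R -> Hinf -> Hinf)
    (HT : strongly_continuous_semigroup T)
    (Hcomp : forall t : R, (0 <= t)%R -> composition_operator (T t)) :
  forall t : R, (0 <= t)%R -> forall f : Hinf, T t f = f.
Proof.
destruct (composition_monomial_fixed T 2 HT Hcomp) as (t2 & Ht2 & F2); [lia|].
destruct (composition_monomial_fixed T 3 HT Hcomp) as (t3 & Ht3 & F3); [lia|].
(* Halving puts the closed interval from 0 to [h] strictly inside both ranges of times. *)
set (h := Rmin t2 t3 / 2).
assert (Hmin : 0 < Rmin t2 t3) by now apply Rmin_pos.
assert (Hh : 0 < h) by (unfold h; lra).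
pose proof (Rmin_l t2 t3). pose proof (Rmin_r t2 t3).
destruct HT as [[_ [HT0 HTadd]] _].
assert (Hsmall : forall t, 0 <= t <= h -> forall f, T t f = f).
{ intros t Ht f. destruct (Req_dec t 0) as [-> | Hne]; [apply HT0|].
  destruct (Hcomp t ltac:(lra)) as (_ & Phi & _ & HPhi).
  apply Hinf_ext. intros s. rewrite HPhi. f_equal.
  destruct (Hinf_monomial 2 ltac:(lia)) as [m2 Hm2].
  destruct (Hinf_monomial 3 ltac:(lia)) as [m3 Hm3].
  assert (E : hp_val (Phi s) = hp_val s).
  { apply dirichlet_terms_separate.
    - rewrite <- !Hm2, <- HPhi. apply F2; [unfold h in Ht; lra | exact Hm2].
    - rewrite <- !Hm3, <- HPhi. apply F3; [unfold h in Ht; lra | exact Hm3]. }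
  destruct (Phi s) as [z Hz], s as [w Hw]. simpl in E. subst w.
  now rewrite (proof_irrelevance _ Hz Hw). }
(* The semigroup law spreads the identity from times up to [h] to all times, peeling off one [h] per
   step. *)
assert (Hall : forall n : nat, forall t, 0 <= t <= INR n * h -> forall f, T t f = f).
{ induction n as [|n IH]; intros t Ht f.
  - apply Hsmall. simpl in Ht. lra.
  - rewrite S_INR in Ht. destruct (Rle_dec t h) as [Hth|Hth]; [apply Hsmall; lra|].
    replace t with (h + (t - h)) by ring.
    rewrite <- HTadd by lra. rewrite Hsmall by lra. apply IH. lra. }
intros t Ht f. destruct (INR_unbounded (t / h)) as [n Hn].
apply (Hall n). apply Rlt_div_l in Hn; [|exact Hh]. lra.
Qed.
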